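(* Let $k,n$ be positive integers. Then the following hold. (i) Suppose $k\leq n$. If $n=5$ then $\mathrm{Smo}(C_{k;n})=3$ and $\widehat{\mathrm{Smo}}(C_{k;n})=1$; otherwise $$\mathrm{Smo}(C_{k;n})-1=\widehat{\mathrm{Smo}}(C_{k;n})=\begin{cases}\lfloor\frac n2\rfloor, & \text{if } n\leq 4 \text{ or } n=7;\\ \lfloor\frac n2\rfloor+1, & \text{if } n=6 \text{ or } n\geq 8.\end{cases}$$ (ii) Suppose $k>n$. Then $\mathrm{Smo}(C_{k;n})\leq\widehat{\mathrm{Smo}}(C_{k;n})+1$. Moreover, $$\begin{cases}\frac{\lceil k/n\rceil n}{2}+1\leq\widehat{\mathrm{Smo}}(C_{k;n})\leq\left\lceil\frac{(\lceil k/n\rceil+1)n}{2}\right\rceil-1, & \text{if } n\geq3 \text{ and } \lceil k/n\rceil n\equiv0\pmod2;\\[4pt] \widehat{\mathrm{Smo}}(C_{k;n})=\left\lfloor\frac{(\lceil k/n\rceil+1)n}{2}\right\rfloor, & \text{otherwise,}\end{cases}$$ and $$\begin{cases}\frac{\lceil k/n\rceil n}{2}+1\leq\mathrm{Smo}(C_{k;n})\leq\left\lceil\frac{(\lceil k/n\rceil+1)n}{2}\right\rceil, & \text{if } n\geq3 \text{ and } \lceil k/n\rceil n\equiv0\pmod2;\\[4pt] \mathrm{Smo}(C_{k;n})=\left\lfloor\frac{(\lceil k/n\rceil+1)n}{2}\right\rfloor, & \text{if } n=2;\\[4pt] \mathrm{Smo}(C_{k;n})=\left\lfloor\frac{(\lceil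 k/n\rceil+1)n}{2}\right\rfloor+1, & \text{otherwise.}\end{cases}$$
   Context: Cyclic semigroups. $C_{k;n}=\langle s\rangle$ denotes the finite cyclic semigroup (written additively) with generator $s$, index $k$ and period $n$: $k$ is the least positive integer such that $ks=ts$ for some positive integer $t\neq k$, and $n$ is the least positive integer with $(k+n)s=ks$. So $C_{k;n}=\{s,2s,\ldots,(k+n-1)s\}$ has $k+n-1$ elements; for $k=1$ it is the cyclic group of order $n$. The generator $s$ is fixed, and for $a\in C_{k;n}$, $\mathrm{ind}(a)$ is the least positive integer $t$ with $ts=a$. An element $e$ is idempotent if $e+e=e$. Sequences. For a set $\mathcal{S}$, $\mathcal{F}(\mathcal{S})$ is the set of finite unordered sequences (multisets) of terms from $\mathcal{S}$, repetition allowed; $|T|$ is the number of terms of $T$ counted with multiplicity. For a commutative semigroup $\mathcal{S}$ and $T\in\mathcal{F}(\mathcal{S})$, $\Sigma(T)$ is the set of all sums of nonempty subsequences of $T$. $\mathop{\bullet}_{a\mid T} f(a)$ denotes the sequence obtained from $T$ by applying $f$ to each term (with multiplicity). $T$ is idempotent-sum free if no nonempty subsequence of $T$ has an idempotent as its sum. $T$ is a minimal idempotent-sum sequence if $T$ is nonempty, the sum of all its terms is an idempotent, and no nonempty proper subsequence of $T$ has an idempotent as its sum. Smooth sequences. Let $G$ be an abelian group and $g\in G$. Let $T\in\mathcal{F}(G)$ be a nonempty sequence of the form $T=(n_1g)\cdot\ldots\cdot(n_\ell g)$ with integers $1=n_1\leq\cdots\leq n_\ell$, $N=n_1+\cdots+n_\ell\leq\mathrm{ord}(g)$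 and $\Sigma(T)=\{g,2g,\ldots,Ng\}$. If $N<\mathrm{ord}(g)$, $T$ is called $g$-smooth; if $N=\mathrm{ord}(g)$, $T$ is called zero-sum $g$-smooth. In particular (taking $G=\mathbb{Z}$, $g=1$, of infinite order), a nonempty sequence $T$ of positive integers is $1$-smooth if and only if $\Sigma(T)=[1,\sum_{a\mid T}a]$, where $[a,b]$ denotes an interval of integers. The invariants. For $\max(k,n)>1$, $\mathrm{Smo}(C_{k;n})$ [resp. $\widehat{\mathrm{Smo}}(C_{k;n})$] is the least positive integer $\ell$ such that every minimal idempotent-sum [resp. idempotent-sum free] sequence $T\in\mathcal{F}(C_{k;n})$ of length at least $\ell$ satisfies: if $k>n$, the sequence $\mathop{\bullet}_{a\mid T}\mathrm{ind}(a)\in\mathcal{F}(\mathbb{Z})$ is $1$-smooth; if $k\leq n$, the sequence $\mathop{\bullet}_{a\mid T}(\mathrm{ind}(a)+n\mathbb{Z})\in\mathcal{F}(\mathbb{Z}/n\mathbb{Z})$ is zero-sum $g$-smooth [resp. $g$-smooth] for some $g\in\mathbb{Z}/n\mathbb{Z}$ with $\mathrm{ord}(g)=n$. By convention $\mathrm{Smo}(C_{1;1})=1$ and $\widehat{\mathrm{Smo}}(C_{1;1})=0$. *)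

(* Defs.v *)
(* MathComp, with mathcomp.classical for sets and classical choice on nat. *)
From HB Require Import structures.
From mathcomp Require Import all_boot all_order all_algebra.
From mathcomp Require Import boolp classical_sets.

Set Implicit Arguments.
Unset Strict Implicit.
Unset Printing Implicit Defensive.

Import GRing.Theory.

Local Open Scope classical_set_scope.
Local Open Scope ring_scope.

(* Finite unordered sequences are represented by lists: every predicate below
   on a list only depends on it up to permutation, and sub-multisets are, up to
   permutation, the sublists given by [subseq]. *)

Section Sums.
Variable S : addSemigroupType.
Implicit Types (T U : seq S) (a e x : S).

(* [sums_to T x]: T is nonempty and x is the sum of its terms. *)
Definition sums_to T x : Prop :=
  if T is a :: U then foldl +%R a U = x else False.

Definition Sigma T : set S := [set x | exists2 U, subseq U T & sums_to U x].

Definition idempotent_elt e : Prop := e + e = e.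

Definition idem_sum_free T : Prop :=
  forall x, Sigma T x -> ~ idempotent_elt x.

Definition min_idem_sum T : Prop :=
  (exists2 e, sums_to T e & idempotent_elt e) /\
  (forall U x, subseq U T -> (size U < size T)%N -> sums_to U x ->
     ~ idempotent_elt x).

(* The multiple t a, for t > 0 (a semigroup has no 0-fold multiple). *)
Definition pmul a (t : nat) : S := iter t.-1 (+%R a) a.

End Sums.

Section Smooth.
Variable G : zmodType.
Implicit Types (g : G) (T : seq G) (N : nat).

(* ord(g) = N, with N finite. *)
Definition has_order g N : Prop :=
  [/\ (0 < N)%N, g *+ N = 0 & forall j, (0 < j < N)%N -> g *+ j != 0].

(* N < ord(g), where ord(g) may be infinite. *)
Definition lt_order N g : Prop := forall j, (0 < j <= N)%N -> g *+ j != 0.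

Definition smooth_shape g T N : Prop :=
  exists ns : seq nat,
    [/\ perm_eq T [seq g *+ m | m <- ns],
        head 0%N ns = 1%N, sorted leq ns, sumn ns = N
      & Sigma T = [set g *+ m | m in [set m | (0 < m <= N)%N]]].

Definition smooth g T : Prop := exists2 N, smooth_shape g T N & lt_order N g.

Definition zero_sum_smooth g T : Prop :=
  exists2 N, smooth_shape g T N & has_order g N.

End Smooth.

(* The cyclic semigroup C_{k;n}, with t s represented by the number t in
   [1, k + n - 1]. For the type to be a nonempty semigroup for all k and n, the
   parameters are replaced by [k.-1.+1] and [n.-1.+1], which are k and n
   when these are positive. *)
Record csg (k n : nat) := Csg {
  csg_val : nat;
  csg_valP : (0 < csg_val < k.-1.+1 + n.-1.+1)%N }.

HB.instance Definition _ k n := [isSub for @csg_val k n].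
HB.instance Definition _ k n := [Countable of csg k n by <:].

(* The t' in [1, k + n - 1] with t s = t' s. *)
Definition csg_red (k n t : nat) : nat :=
  if (t < k)%N then t else (k + (t - k) %% n)%N.

Lemma csg_red_bound k n t : (0 < t)%N ->
  (0 < csg_red k.-1.+1 n.-1.+1 t < k.-1.+1 + n.-1.+1)%N.
Proof.
move=> t0; rewrite /csg_red; case: (ltnP t) => tk.
  by rewrite t0 (leq_trans tk) // leq_addr.
by rewrite addSn ltnS leq0n /= -addSn ltn_add2l ltn_mod.
Qed.

Lemma csg_red_id k n t : (t < k + n)%N -> csg_red k n t = t.
Proof.
rewrite /csg_red => tkn; case: ltnP => // tk.
by rewrite modn_small ?subnKC // ltn_subLR.
Qed.

Lemma csg_redDl k n t u : csg_red k n (csg_red k n t + u) = csg_red k n (t + u).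
Proof.
rewrite /csg_red; case: (ltnP t k) => // tk.
rewrite !ltnNge (leq_trans tk (leq_addr _ _)) -addnA leq_addr /=.
by rewrite addKn modnDml addnBAC.
Qed.

Section CyclicSemigroup.
Variables k n : nat.
Implicit Types a b c : csg k n.

Definition csg_of t (t0 : (0 < t)%N) : csg k n := Csg (csg_red_bound k n t0).

Fact csg_add_subproof a b : (0 < val a + val b)%N.
Proof. by case: a => [[|t]] //= _; rewrite addSn. Qed.

Definition csg_add a b : csg k n := csg_of (csg_add_subproof a b).

Fact csg_addC : commutative csg_add.
Proof. by move=> a b; apply: val_inj; rewrite /= addnC. Qed.

Fact csg_addA : associative csg_add.
Proof.
move=> a b c; apply: val_inj => /=.
by rewrite csg_redDl addnC csg_redDl addnC addnA.
Qed.

HB.instance Definition _ := GRing.isAddSemigroup.Build (csg k n) csg_addC csg_addA.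

Definition csg_gen : csg k n := csg_of (ltn0Sn 0).

Lemma val_pmul_gen t : (0 < t)%N ->
  val (pmul csg_gen t) = csg_red k.-1.+1 n.-1.+1 t.
Proof.
case: t => // t _; elim: t => // t IHt.
rewrite /pmul /= in IHt *; rewrite IHt csg_redDl.
by rewrite addnC csg_redDl addn1.
Qed.

Lemma pmul_gen_val a : pmul csg_gen (val a) = a.
Proof.
apply: val_inj; have /andP[a0 aM] := csg_valP a.
by rewrite val_pmul_gen // csg_red_id.
Qed.

Lemma csg_gen_spans a : exists t, (0 < t)%N && (pmul csg_gen t == a).
Proof.
exists (val a); rewrite pmul_gen_val eqxx andbT.
by case/andP: (csg_valP a).
Qed.

Definition ind a : nat := ex_minn (csg_gen_spans a).

Lemma indE a : ind a = val a.
Proof.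
rewrite /ind; case: ex_minnP => t /andP[t0 /eqP ta] tmin.
have /andP[a0 aM] := csg_valP a.
have ta_le : (t <= val a)%N by apply: tmin; rewrite a0 pmul_gen_val eqxx.
by rewrite -[in RHS]ta val_pmul_gen // csg_red_id // (leq_ltn_trans ta_le).
Qed.

Hypotheses (k0 : (0 < k)%N) (n0 : (0 < n)%N).

Lemma csg_index :
  (exists t, [/\ (0 < t)%N, t != k & pmul csg_gen k = pmul csg_gen t]) /\
  (forall j t, (0 < j < k)%N -> (0 < t)%N -> t != j ->
     pmul csg_gen j != pmul csg_gen t).
Proof.
split.
  exists (k + n)%N; split; first by rewrite addn_gt0 k0.
    by rewrite -{2}[k]addn0 eqn_add2l -lt0n.
  apply: val_inj; rewrite !val_pmul_gen ?addn_gt0 ?k0 // !prednK //.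
  by rewrite /csg_red ltnn ltnNge leq_addr /= addKn modnn subnn mod0n.
move=> j t /andP[j0 jk] t0; apply: contra => /eqP/(congr1 val)/eqP.
rewrite !val_pmul_gen // !prednK // /csg_red jk; case: ltnP => [_|tk].
  by rewrite eq_sym.
by rewrite eqn_leq andbC leqNgt (leq_trans jk (leq_addr _ _)).
Qed.

Lemma csg_period :
  pmul csg_gen (k + n) = pmul csg_gen k /\
  (forall m, (0 < m < n)%N -> pmul csg_gen (k + m) != pmul csg_gen k).
Proof.
have kP m : (0 < k + m)%N by rewrite addn_gt0 k0.
split.
  apply: val_inj; rewrite !val_pmul_gen // !prednK //.
  by rewrite /csg_red ltnn ltnNge leq_addr /= addKn modnn subnn mod0n.
move=> m /andP[m0 mn]; apply/eqP => /(congr1 val)/eqP.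
rewrite !val_pmul_gen // !prednK // !csg_red_id.
- by rewrite -{2}[k]addn0 eqn_add2l -[m == _]negbK -lt0n m0.
- by rewrite -{1}[k]addn0 ltn_add2l.
- by rewrite ltn_add2l.
Qed.

End CyclicSemigroup.

(* The least positive integer satisfying P. The default value 0 is taken only
   when there is none, and is then distinct from any genuine value. *)
Definition least_pos (P : nat -> Prop) : nat :=
  xget 0%N [set l | [/\ (0 < l)%N, P l
                      & forall m, (0 < m)%N -> P m -> (l <= m)%N]].

(* The ring 'Z_n is Z/nZ only for n > 1, which holds when k <= n and
   (k, n) is not (1, 1). *)
Definition Smo (k n : nat) : nat :=
  if (k == 1%N) && (n == 1%N) then 1%N else
  least_pos (fun l => forall T : seq (csg k n),
    min_idem_sum T -> (l <= size T)%N ->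
    if (n < k)%N then smooth (1 : int) [seq (ind a)%:Z | a <- T]
    else exists2 g : 'Z_n, has_order g n
           & zero_sum_smooth g [seq (ind a)%:R | a <- T]).

Definition hSmo (k n : nat) : nat :=
  if (k == 1%N) && (n == 1%N) then 0%N else
  least_pos (fun l => forall T : seq (csg k n),
    idem_sum_free T -> (l <= size T)%N ->
    if (n < k)%N then smooth (1 : int) [seq (ind a)%:Z | a <- T]
    else exists2 g : 'Z_n, has_order g n
           & smooth g [seq (ind a)%:R | a <- T]).

(* The ceiling of m / d, for d > 0. *)
Definition ceil_div (m d : nat) : nat := ((m + d.-1) %/ d)%N.

(* Main.v *)
Require Import Defs.
From mathcomp Require Import all_boot all_order all_algebra.
From mathcomp Require boolp classical_sets.
From mathcomp Require Import zify.

(* The element t s of C_{k;n} is idempotent if and only if n divides t and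
   t >= k, that is, t >= c n for c = ceil (k / n).

   For k <= n everything takes place in Z/nZ, and the upper bounds are the
   Savchev-Chen theorem: a zero-sum free sequence of length l with at most
   2 l - 2 nonempty subsequence sums is smooth. If the removal of some term
   loses at least two sums, induct; otherwise every removal loses only the total
   sum, and this forces all terms to be equal.

   For k > n and n >= 3, let W be a longest subsequence with sum divisible by n,
   of largest sum among these. The rest is zero-sum free modulo n, so it is either
   short, and then W contains many ones, or smooth modulo n, and then exchanging
   ones of W for terms outside W shows that the sequence has at least n - 1 ones.
   With n - 1 ones, the total is less than c n, because a larger total could be
   lowered to a multiple of n; so the sum is less than twice the length, and such
   a sequence of positive integers is 1-smooth. *)

Set Implicit Arguments.
Unset Strict Implicit.
Unset Printing Implicit Defensive.

Import GRing.Theory.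

(** * Subset sums of positive integers *)

(** Let S < n be the sum of the coefficients outside W. The sum of W is at most (c - 1) n, so the
    length hypothesis forces at least 2 n - 2 - 2 |~W| ones in W, while at least 2 |~W| - S terms
    outside W have coefficient 1. These counts add up to n - 1 or more, provided that the
    coefficients refer to g = 1 and that coefficient 1 means value 1. The maximal length of W gives
    the former, its maximal sum the latter. For even n the slack is one unit smaller, which leaves
    two borderline cases: n - 2 ones, or none in W. The lower bounds come from sequences without
    ones, made of twos and at most two threes: parity, or a total one above a multiple of n, keeps
    their sums off the idempotents. For k <= n such a sequence must in addition fail for every
    generator g, which excludes n = 4, 5, 7. *)

Section SumsOverSets.
Variables (I : finType) (x : I -> nat).
Implicit Types A J : {set I}.

Lemma sum_setD1 A i : i \in A ->
  \sum_(j in A) x j = x i + \sum_(j in A :\ i) x j.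
Proof. by move=> iA; rewrite (big_setD1 i). Qed.

Lemma sum_setID A J : J \subset A ->
  \sum_(j in A) x j = \sum_(j in J) x j + \sum_(j in A :\: J) x j.
Proof.
move=> JA; rewrite (big_setID J) /=.
by have/setIidPr -> := JA.
Qed.

Lemma sum_setU A J : [disjoint A & J] ->
  \sum_(j in A :|: J) x j = \sum_(j in A) x j + \sum_(j in J) x j.
Proof. by move=> dAJ; rewrite -bigU //; apply: eq_bigl => i; rewrite !inE. Qed.

Lemma card_leq_sum A : (forall i, i \in A -> 0 < x i) ->
  #|A| <= \sum_(i in A) x i.
Proof. by move=> x_gt0; rewrite -sum1_card; apply: leq_sum. Qed.

(* Removing a term at least 2 preserves the bound on the sum; if there is none,
   all terms are 1. *)
Lemma subset_sums_interval A m : (forall i, i \in A -> 0 < x i) ->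
  \sum_(i in A) x i < 2 * #|A| -> m <= \sum_(i in A) x i ->
  exists2 J : {set I}, J \subset A & \sum_(i in J) x i = m.
Proof.
have [l] := ubnP #|A|; elim: l => // l IHl in A m *.
rewrite ltnS => Al x_gt0 sumA mA.
have [->|m_gt0] := posnP m; first by exists set0; rewrite ?sub0set ?big_set0.
have /card_gt0P[i0 i0A] : 0 < #|A| by lia.
have [i [iA geA]] : exists i, i \in A /\
    ((2 <= x i) || [forall j in A, x j == 1]).
  case: (boolP [exists i in A, 2 <= x i]) => [/exists_inP[i iA xi2]|].
    by exists i; rewrite xi2.
  rewrite negb_exists_in => /forall_inP all1; exists i0; split=> //.
  apply/orP; right; apply/forall_inP => j jA.
  by rewrite eqn_leq x_gt0 // andbT leqNgt all1.
(* The other terms sum to at least [#|A| - 1], so [x i] exceeds their sum by at most 1: the interval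
   of sums of [A :\ i] and its translate by [x i] leave no gap. The first alternative of [smallD]
   covers a singleton [A]. *)
have /andP[xi_le smallD] : (x i <= \sum_(j in A :\ i) x j + 1) &&
    ((#|A :\ i| == 0) || (\sum_(j in A :\ i) x j < 2 * #|A :\ i|)).
  have xD_gt0 j : j \in A :\ i -> 0 < x j by case/setD1P => _ /x_gt0.
  have := card_leq_sum xD_gt0.
  have cardA := cardsD1 i A; have sumAi := sum_setD1 iA.
  rewrite iA /= in cardA.
  case/orP: geA => [|/forall_inP x1]; first by lia.
  have -> : \sum_(j in A :\ i) x j = #|A :\ i|.
    by rewrite -sum1_card; apply: eq_bigr => j /setD1P[_ /x1/eqP].
  by rewrite (eqP (x1 i iA)); lia.
have sumAi := sum_setD1 iA.
have ltAi : #|A :\ i| < l by have := cardsD1 i A; rewrite iA /=; lia.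
have subAi : A :\ i \subset A by apply: subD1set.
have IH m' : m' <= \sum_(j in A :\ i) x j ->
    exists2 J : {set I}, J \subset A :\ i & \sum_(j in J) x j = m'.
  move=> m'_le; case/orP: smallD => [|smallD].
    rewrite cards_eq0 => /eqP Ai0.
    by exists (A :\ i); rewrite // Ai0 in m'_le *; rewrite big_set0 in m'_le *; lia.
  apply: IHl => // j; by case/setD1P => _ /x_gt0.
have [mAi|mAi] := leqP m (\sum_(j in A :\ i) x j).
  by have [J JAi] := IH m mAi; exists J => //; apply: subset_trans JAi subAi.
have [|J JAi sumJ] := IH (m - x i); first by lia.
exists (i |: J); first by rewrite subUset sub1set iA (subset_trans JAi).
have iJ : i \notin J by apply: contraTN (iA) => /(subsetP JAi); rewrite !inE eqxx.
by rewrite big_setU1 //= sumJ; lia.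
Qed.

(** Each term plus the indicator that it equals 1 is at least 2. This supplies both the ones of [W]
    and the coefficients 1 outside [W]. *)
Lemma card_eq1_ge A : (forall i, i \in A -> 0 < x i) ->
  2 * #|A| <= \sum_(i in A) x i + #|[set i in A | x i == 1]|.
Proof.
move=> x_gt0; have -> : #|[set i in A | x i == 1]| = \sum_(i in A) (x i == 1).
  rewrite -sum1_card big_mkcond [RHS]big_mkcond; apply: eq_bigr => i _.
  by rewrite inE; case: (i \in A); case: eqP.
rewrite mulnC -sum_nat_const -big_split; apply: leq_sum => i /x_gt0 /=.
by case: eqP; lia.
Qed.

End SumsOverSets.

Local Open Scope ring_scope.

(** * The Savchev-Chen theorem *)

Section SavchevChen.
Variables (G : finZmodType) (I : finType) (f : I -> G).
Implicit Types A J : {set I}.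

Definition sigma J : G := \sum_(i in J) f i.

(** The empty subset contributes 0, so the bound [2 l - 2] on the number of nonempty sums reads
    [#|sumset A| < 2 * #|A|]. *)
Definition sumset A : {set G} := [set sigma J | J in powerset A].

Definition zero_free A := forall J, J \subset A -> sigma J = 0 -> J = set0.

Lemma sumsetP A y : reflect (exists2 J : {set I}, J \subset A & y = sigma J) (y \in sumset A).
Proof.
by apply: (iffP imsetP) => -[J]; [rewrite inE|] => JA ->; exists J; rewrite ?inE.
Qed.

Lemma zero_freeS A J : J \subset A -> zero_free A -> zero_free J.
Proof. by move=> JA zA K KJ; apply: zA; apply: subset_trans JA. Qed.

Lemma sumsetS A J : J \subset A -> sumset J \subset sumset A.
Proof.
move=> JA; apply/subsetP => y /sumsetP[K KJ ->].
by apply/sumsetP; exists K => //; apply: subset_trans JA.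
Qed.

Lemma sigmaD A J : J \subset A -> sigma (A :\: J) = sigma A - sigma J.
Proof.
move=> JA; rewrite /sigma (big_setID J (A := A)) /=.
by have/setIidPr -> := JA; rewrite addrC addrK.
Qed.

Lemma sigmaU1 J i : i \notin J -> sigma (i |: J) = f i + sigma J.
Proof. by move=> iJ; rewrite /sigma big_setU1. Qed.

Lemma sumset_sym A y : y \in sumset A -> sigma A - y \in sumset A.
Proof.
case/sumsetP => J JA ->; apply/sumsetP; exists (A :\: J); first exact: subsetDl.
by rewrite sigmaD.
Qed.

Lemma notin_subsetD1 A J i : J \subset A :\ i -> i \notin J.
Proof. by move=> JA; apply/negP => /(subsetP JA); rewrite !inE eqxx. Qed.

Lemma sumsetD1 A i : i \in A ->
  sumset A = sumset (A :\ i) :|: [set f i + y | y in sumset (A :\ i)].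
Proof.
move=> iA; apply/setP => y; rewrite inE; apply/idP/orP.
  case/sumsetP => J JA ->; case: (boolP (i \in J)) => iJ; last first.
    by left; apply/sumsetP; exists J; rewrite // subsetD1 JA.
  right; apply/imsetP; exists (sigma (J :\ i)).
    by apply/sumsetP; exists (J :\ i); rewrite // setSD.
  by rewrite /sigma (big_setD1 i).
case=> [|/imsetP[z /sumsetP[J JA ->] ->]].
  by apply/subsetP/sumsetS; rewrite subD1set.
apply/sumsetP; exists (i |: J); last by rewrite sigmaU1 // (notin_subsetD1 JA).
by rewrite subUset sub1set iA (subset_trans JA) ?subD1set.
Qed.

Lemma sumsetD1_add A i y : i \in A -> y \in sumset (A :\ i) -> f i + y \in sumset A.
Proof. by move=> iA yA; rewrite (sumsetD1 iA) inE imset_f ?orbT. Qed.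

Lemma zero_free_opp A i : zero_free A -> i \in A -> - f i \notin sumset (A :\ i).
Proof.
move=> zA iA; apply/negP => /sumsetP[J JA eJ].
have: i |: J = set0.
  apply: zA; first by rewrite subUset sub1set iA (subset_trans JA) ?subD1set.
  by rewrite sigmaU1 ?(notin_subsetD1 JA) // -eJ subrr.
by move/setP/(_ i); rewrite !inE eqxx.
Qed.

Lemma sigma_notin A i : zero_free A -> i \in A -> sigma A \notin sumset (A :\ i).
Proof.
move=> zA iA; apply/negP => /sumsetP[J JA eJ].
have: A :\: J = set0.
  apply: zA; rewrite ?subsetDl // sigmaD ?eJ ?subrr //.
  by rewrite (subset_trans JA) ?subD1set.
by move/setP/(_ i); rewrite !inE iA (notin_subsetD1 JA).
Qed.

(* A term whose removal loses a single sum loses exactly the total sum. *)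
Lemma tight_term A i y : zero_free A -> i \in A ->
  (#|sumset A| <= #|sumset (A :\ i)|.+1)%N ->
  y \in sumset A -> y != sigma A -> y \in sumset (A :\ i).
Proof.
move=> zA iA cA yA ys.
have sAi : sigma A |: sumset (A :\ i) \subset sumset A.
  rewrite subUset sub1set sumsetS ?subD1set // andbT.
  by apply/sumsetP; exists A.
have /eqP eA : sigma A |: sumset (A :\ i) == sumset A.
  by rewrite eqEcard sAi cardsU1 sigma_notin.
by move: yA; rewrite -eA !inE (negPf ys).
Qed.

(** If the removal of [b] loses only the total, then [f b] can be subtracted from any nonzero sum:
    complement, add [f b], complement. For [f b != f c], subtracting [f b] and then [f c] from [f c]
    makes [- f b] a sum. It is no sum avoiding [b], so it is the total; by symmetry so is
    [- f c]. *)
Lemma tight_terms_eq A i j : zero_free A -> i \in A -> j \in A ->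
  (#|sumset A| <= #|sumset (A :\ i)|.+1)%N ->
  (#|sumset A| <= #|sumset (A :\ j)|.+1)%N -> f i = f j.
Proof.
move=> zA iA jA ti tj; apply/eqP; apply: contraT => neq_ij.
have sub b y : b \in A -> (#|sumset A| <= #|sumset (A :\ b)|.+1)%N ->
    y \in sumset A -> y != 0 -> y - f b \in sumset A.
  move=> bA tb yA y0; have := sumset_sym yA => sAy.
  have: sigma A - y \in sumset (A :\ b).
    by apply: tight_term => //; rewrite -subr_eq0 addrC addKr oppr_eq0.
  move/(sumsetD1_add bA)/sumset_sym.
  by rewrite opprD opprB addrCA (addrC (sigma A)) subrK addrC.
have fA b : b \in A -> f b \in sumset A.
  move=> bA; apply/sumsetP; exists [set b]; rewrite ?sub1set //.
  by rewrite /sigma big_set1.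
have f0 b : b \in A -> f b != 0.
  move=> bA; apply/eqP => fb0; have: [set b] = set0.
    by apply: zA; rewrite ?sub1set // /sigma big_set1.
  by move/setP/(_ b); rewrite !inE eqxx.
have opp b c : b \in A -> c \in A -> f b != f c ->
    (#|sumset A| <= #|sumset (A :\ b)|.+1)%N ->
    (#|sumset A| <= #|sumset (A :\ c)|.+1)%N -> - f b = sigma A.
  move=> bA cA nbc tb tc; apply/eqP; apply: contraT => nb.
  have: f c - f b - f c \in sumset A.
    by apply: (sub c) => //; [apply: (sub b); rewrite ?fA ?f0 | rewrite subr_eq0 eq_sym].
  rewrite addrC addKr => /(tight_term zA bA tb)/(_ nb).
  by rewrite (negPf (zero_free_opp zA bA)).
have nji : f j != f i by rewrite eq_sym.
by case/eqP: (neq_ij); apply: oppr_inj; rewrite (opp i j) // (opp j i).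
Qed.

Lemma card_mulrn_prefix (a : G) S : (forall j, (0 < j <= S)%N -> a *+ j != 0) ->
  #|[set a *+ val j | j in 'I_S.+1]| = S.+1.
Proof.
move=> a0; rewrite card_imset ?card_ord // => u v /= /eqP.
wlog le_uv : u v / (u <= v)%N.
  by move=> H e; have [/H|/ltnW/H] := leqP u v; [apply|rewrite eq_sym => /(_ e)].
rewrite eq_sym -subr_eq0 -mulrnBr // => e0; apply: val_inj => /=.
apply/eqP; rewrite eqn_leq le_uv /= leqNgt; apply/negP => lt_uv.
by have := ltn_ord v; have := a0 (v - u)%N; rewrite e0; lia.
Qed.

(** The conclusion carries the whole sumset because the inductive step needs it to locate the
    removed term. *)
Theorem savchev_chen A : zero_free A -> A != set0 ->
  (#|sumset A| < 2 * #|A|)%N ->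
  exists (a : G) (x : I -> nat),
   [/\ forall i, i \in A -> (0 < x i)%N /\ f i = a *+ x i,
       forall j, (0 < j <= \sum_(i in A) x i)%N -> a *+ j != 0
     & sumset A = [set a *+ val j | j in 'I_(\sum_(i in A) x i).+1]].
Proof.
have [l] := ubnP #|A|; elim: l => // l IHl in A *; rewrite ltnS => Al zA A0 cA.
case: (boolP [exists b in A, #|sumset (A :\ b)| + 2 <= #|sumset A|])%N; last first.
  rewrite negb_exists_in => /forall_inP tight.
  have /set0Pn[b bA] := A0; exists (f b), (fun=> 1%N); rewrite sum1_card.
  have fE i : i \in A -> f i = f b.
    by move=> iA; apply: (tight_terms_eq zA iA bA);
      [move: (tight i iA)|move: (tight b bA)]; rewrite -ltnNge addn2 ltnS.
  have sigmaE J : J \subset A -> sigma J = f b *+ #|J|.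
    move=> JA; rewrite /sigma -sumr_const; apply: eq_bigr => i iJ.
    by rewrite fE ?(subsetP JA).
  have exJ j : (j <= #|A|)%N -> exists2 J : {set I}, J \subset A & #|J| = j.
    move=> jA; have [|||J JA] := @subset_sums_interval _ (fun=> 1%N) A j; rewrite ?sum1_card //.
      by have: (0 < #|A|)%N by [apply/card_gt0P; exists b]; lia.
    by exists J.
  split=> [i iA|j /andP[j0 jA]|]; first by rewrite fE.
  - have [J JA cJ] := exJ j jA; rewrite -cJ -sigmaE //.
    by apply: contraTneq j0 => /(zA _ JA) J0; rewrite -cJ J0 cards0.
  apply/setP => y; apply/sumsetP/imsetP.
    case=> J JA ->; have cJ := subset_leq_card JA.
    by exists (Ordinal (cJ : #|J| < #|A|.+1)%N); rewrite //= sigmaE.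
  case=> j _ ->; have [J JA cJ] := exJ j (ltn_ord j).
  by exists J; rewrite // sigmaE // cJ.
case/exists_inP => b bA cAb; set B := A :\ b in cAb *.
have cardA : #|A| = #|B|.+1 by rewrite (cardsD1 b A) bA.
have BA : B \subset A by apply: subD1set.
have B0 : B != set0.
  rewrite -cards_eq0; apply: contraL cAb => /eqP B0.
  by rewrite -ltnNge; have := subset_leq_card (subsetT (sumset B)); lia.
have [||a [x [xE a_neq0 DE]]] := IHl B _ (zero_freeS BA zA) B0; try by lia.
set S := \sum_(i in B) x i in a_neq0 DE *.
have cardDB : #|sumset B| = S.+1 by rewrite DE card_mulrn_prefix.
have leBS : (#|B| <= S)%N by apply: card_leq_sum => i /xE[].
have memB y : reflect (exists2 j, (j <= S)%N & y = a *+ j) (y \in sumset B).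
  rewrite DE; apply: (iffP imsetP) => [[j _ ->]|[j jS ->]].
    by exists j; rewrite // -ltnS.
  by exists (Ordinal (jS : j < S.+1)%N).
have nadd0 y : y \in sumset B -> f b + y != 0.
  move=> yB; apply/eqP => /eqP; rewrite addr_eq0 eq_sym eqr_oppLR => /eqP yE.
  by move: (zero_free_opp zA bA); rewrite -yE yB.
have nadd0' j : (j <= S)%N -> f b + a *+ j != 0.
  by move=> jS; apply: nadd0; apply/memB; exists j.
(* Were [sumset B] and its translate by [f b] disjoint, [A] would have [2 * S.+1 >= 2 * #|A|] sums.
   So [a *+ u = f b + a *+ v] with [u, v <= S], and [u <= v] would make [- f b] a sum of [B]. *)
have [X /andP[X0 XS] fbE] : exists2 X, (0 < X <= S)%N & f b = a *+ X.
  have: sumset B :&: [set f b + y | y in sumset B] != set0.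
    apply: contraTneq cA => dis; rewrite -leqNgt (sumsetD1 bA).
    rewrite cardsU dis cards0 subn0 (card_imset _ (addrI (f b))).
    by rewrite cardDB cardA; lia.
  case/set0Pn => y /setIP[/memB[u uS ->] /imsetP[_ /memB[v vS ->]]].
  have [le_uv|lt_vu] := leqP u v.
    rewrite -(subnK le_uv) mulrnDr addrA -{1}[a *+ u]add0r => /addIr/esym/eqP.
    by rewrite (negPf (nadd0' _ _)) //; lia.
  move=> e; exists (u - v)%N; first by lia.
  by apply: (@addIr _ (a *+ v)); rewrite -e -mulrnDr subnK // ltnW.
pose x' i := if i == b then X else x i.
have x'B i : i \in B -> x' i = x i.
  by rewrite !inE /x' => /andP[/negPf->].
have sumA : (\sum_(i in A) x' i)%N = (X + S)%N.
  by rewrite (sum_setD1 _ bA) /x' eqxx; congr (_ + _)%N; apply: eq_bigr.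
exists a, x'; rewrite sumA; split=> [i iA|j /andP[j0 jS]|].
- rewrite /x'; case: eqP => [->|/eqP ib]; first by rewrite X0.
  by apply: xE; rewrite !inE ib.
- have [jS'|Sj] := leqP j S; first by apply: a_neq0; rewrite j0.
  have -> : j = (X + (j - X))%N by lia.
  by rewrite mulrnDr -fbE nadd0' //; lia.
apply/setP => y; rewrite (sumsetD1 bA) -/B inE; apply/orP/imsetP.
  case=> [/memB[j jS ->]|/imsetP[_ /memB[j jS ->] ->]].
    have jXS : (j < (X + S).+1)%N by lia.
    by exists (Ordinal jXS).
  have jXS : (X + j < (X + S).+1)%N by lia.
  by exists (Ordinal jXS) => //=; rewrite mulrnDr fbE.
case=> -[j jXS] _ -> /=; have [jS|Sj] := leqP j S.
  by left; apply/memB; exists j.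
right; apply/imsetP; exists (a *+ (j - X)).
  by apply/memB; exists (j - X)%N => //; lia.
by rewrite fbE -mulrnDr; congr (a *+ _); lia.
Qed.

End SavchevChen.

(** * Long sequences of integers *)

Section IntegersModN.
Variables (n : nat) (n_gt1 : (1 < n)%N).

Lemma natr_Zn_eq (a b : nat) : (a%:R == b%:R :> 'Z_n) = (a == b %[mod n]).
Proof. by rewrite -val_eqE /= !val_Zp_nat. Qed.

Lemma natr_Zn_eq0 (a : nat) : (a%:R == 0 :> 'Z_n) = (n %| a)%N.
Proof. by rewrite (natr_Zn_eq a 0) mod0n. Qed.

Lemma card_Zn : #|'Z_n| = n.
Proof. by rewrite card_ord Zp_cast. Qed.

Lemma mulrn_Zn (g : 'Z_n) : g *+ n = 0.
Proof. by rewrite -[g]natr_Zp -mulrnA; apply/eqP; rewrite natr_Zn_eq0 dvdn_mull. Qed.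

Lemma has_order_gen (g y : 'Z_n) : has_order g n ->
  exists2 j, (j < n)%N & y = g *+ j.
Proof.
case=> n_gt0 _ g_neq0.
have cn : #|[set g *+ val j | j in 'I_n.-1.+1]| = n.
  rewrite card_mulrn_prefix ?prednK // => j /andP[j0 jn].
  by apply: g_neq0; lia.
have /eqP imT : [set g *+ val j | j in 'I_n.-1.+1] == setT.
  by rewrite eqEcard subsetT cardsT cn card_Zn leqnn.
have := in_setT y; rewrite -imT => /imsetP[j _ ->].
by exists (val j) => //; case: j => j /=; lia.
Qed.

(** If [g *+ j = 0] with [0 < j < n], then [gcdn j n] also annihilates [g]; as a proper divisor of
    [n] it is at most [n / 2 <= S]. *)
Lemma has_orderP (g : 'Z_n) S : (n <= 2 * S)%N ->
  (forall j, (0 < j <= S)%N -> g *+ j != 0) -> has_order g n.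
Proof.
move=> nS g_neq0; split; [lia | exact: mulrn_Zn |] => j /andP[j0 jn].
apply/eqP => gj; pose d := gcdn j n.
have gd : g *+ d = 0.
  have [[a b] /= e] : exists ab, (ab.1 * j = ab.2 * n + d)%N.
    by case: (egcdnP n j0) => a b e _; exists (a, b).
  have /eqP := congr1 (fun m => g *+ m) e.
  by rewrite mulrnDr !(mulnC _ n, mulnC _ j) !mulrnA gj mulrn_Zn !mul0rn add0r => /eqP.
have /dvdnP[q nE] : (d %| n)%N by apply: dvdn_gcdr.
have d_gt0 : (0 < d)%N by rewrite gcdn_gt0 j0.
have dj : (d <= j)%N by rewrite dvdn_leq // dvdn_gcdl.
have q2 : (1 < q)%N by case: q nE => [|[|q]]; lia.
have : (q * d >= 2 * d)%N by rewrite leq_mul2r q2 orbT.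
by move=> le2; have := g_neq0 d; rewrite gd eqxx d_gt0; lia.
Qed.

(** With more than [n / 2] terms the bound on the number of sums is automatic, as ['Z_n] has [n]
    elements. The sum of the coefficients then exceeds [n / 2], which forces order [n]. *)
Theorem savchev_chen_Zn (I : finType) (t : I -> nat) (A : {set I}) :
  (forall J : {set I}, J \subset A -> (n %| \sum_(i in J) t i)%N -> J = set0) ->
  (n < 2 * #|A|)%N ->
  exists (g : 'Z_n) (x : I -> nat),
   [/\ has_order g n, forall i, i \in A -> (0 < x i)%N /\ (t i)%:R = g *+ x i
     & (\sum_(i in A) x i < n)%N].
Proof.
move=> zA nA.
have [|||g [x [xE g_neq0 _]]] :=
  @savchev_chen _ _ (fun i => (t i)%:R : 'Z_n) A.
- by move=> J JA /eqP; rewrite /sigma -natr_sum natr_Zn_eq0; apply: zA.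
- by rewrite -cards_eq0; lia.
- by apply: leq_ltn_trans (max_card _) _; rewrite card_Zn.
have cA : (#|A| <= \sum_(i in A) x i)%N by apply: card_leq_sum => i /xE[].
have og : has_order g n by apply: has_orderP g_neq0; lia.
exists g, x; split=> //; rewrite ltnNge; apply/negP => nS.
by have := g_neq0 n; rewrite mulrn_Zn eqxx; lia.
Qed.

Lemma has_order_neq0 (g : 'Z_n) j : has_order g n -> (0 < j < n)%N -> g *+ j != 0.
Proof. by case=> _ _; apply. Qed.

End IntegersModN.

Local Close Scope ring_scope.

(** * Long sequences with no sum among the multiples of n from c n on *)

Section LongSequences.
Variables (I : finType) (t : I -> nat) (n c : nat).
Hypotheses (t_gt0 : forall i, 0 < t i) (n_gt2 : 2 < n) (c_gt1 : 1 < c).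
Hypothesis free : forall J : {set I},
  n %| \sum_(i in J) t i -> \sum_(i in J) t i < c * n.
Hypothesis long : (c + 1) * n <= 2 * #|I| + 2.
(** For [n] and [c] odd, [(c + 1) * n / 2 - 1] twos satisfy [free] and [long] although their total
    is at least [c * n]; this bound excludes them. *)
Hypothesis long_odd : odd n -> (c + 1) * n <= 2 * #|I| + 1.
Implicit Types J Q U : {set I}.

Local Notation s J := (\sum_(i in J) t i).
Let ones := [set i | t i == 1].

Lemma sum_ones J : J \subset ones -> s J = #|J|.
Proof.
move=> Jo; rewrite -sum1_card; apply: eq_bigr => i /(subsetP Jo).
by rewrite inE => /eqP.
Qed.

Lemma exists_subset_card (A : {set I}) m : m <= #|A| ->
  exists2 J : {set I}, J \subset A & #|J| = m.
Proof.
case: m => [|m] mA; first by exists set0; rewrite ?sub0set ?cards0.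
have [|||J JA] := @subset_sums_interval _ (fun=> 1) A m.+1; rewrite ?sum1_card //.
  by lia.
by exists J.
Qed.

(* If all residues are subset sums, the excess of the total over a multiple of n
   can be removed, which leaves a multiple of n. *)
Lemma sum_lt_of_residues :
  (forall r, r < n -> exists J : {set I}, s J = r) -> s setT < c * n.
Proof.
move=> res; rewrite ltnNge; apply/negP => le_cn.
have [|J sJ] := res (s setT %% n); first by rewrite ltn_mod; lia.
have sT := sum_setID t (subsetT J); have dT := divn_eq (s setT) n.
have sC : s (setT :\: J) = s setT %/ n * n by lia.
have := @free (setT :\: J); rewrite sC dvdn_mull // => /(_ isT).
by rewrite ltn_mul2r => /andP[_]; rewrite ltnNge leq_divRL ?le_cn //; lia.
Qed.

Lemma sum_lt_of_ones : n <= #|ones| + 1 -> s setT < c * n.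
Proof.
move=> no; apply: sum_lt_of_residues => r rn.
have [|J Jo cJ] := @exists_subset_card ones r; first by lia.
by exists J; rewrite sum_ones.
Qed.

Lemma exists_optimal : exists W : {set I}, [/\ n %| s W,
  forall J, n %| s J -> #|J| <= #|W| &
  forall J, n %| s J -> #|J| = #|W| -> s J <= s W].
Proof.
(* As [s J <= s setT], this weight orders the pairs of cardinality and sum lexicographically. *)
pose wt J := #|J| * (s setT).+1 + s J.
have n0 : n %| s set0 by rewrite big_set0.
have ltT J : s J < (s setT).+1 by rewrite ltnS (sum_setID t (subsetT J)) leq_addr.
have [W nW maxW] := @arg_maxnP _ set0 (fun J => n %| s J) wt n0.
have {}maxW J : n %| s J -> wt J <= wt W by move=> nJ; apply: maxW.
exists W; split=> // J nJ; last first.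
  by move=> cJ; have := maxW J nJ; rewrite /wt cJ; lia.
rewrite leqNgt; apply/negP => ltWJ; have := maxW J nJ; rewrite leqNgt => /negP; apply.
rewrite /wt; have := ltT W; have : #|W|.+1 * (s setT).+1 <= #|J| * (s setT).+1.
  by rewrite leq_mul2r ltWJ orbT.
by rewrite mulSn; lia.
Qed.

Section Optimal.
Variable W : {set I}.
Hypothesis W_dvd : n %| s W.
Hypothesis W_card : forall J, n %| s J -> #|J| <= #|W|.
Hypothesis W_sum : forall J, n %| s J -> #|J| = #|W| -> s J <= s W.

Lemma exchange Q U : Q \subset W -> U \subset ~: W -> s Q = s U %[mod n] ->
  #|U| <= #|Q| /\ (#|U| = #|Q| -> s U <= s Q).
Proof.
move=> QW UW QU; pose J := (W :\: Q) :|: U.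
have dis : [disjoint W :\: Q & U].
  by rewrite disjoint_sym disjoints_subset (subset_trans UW) // setCS subsetDl.
have sW := sum_setID t QW; have sJ := sum_setU t dis.
have cW := cardsD W Q; have /setIidPr IQ := QW; rewrite IQ in cW.
have cQ := subset_leq_card QW.
have cJ : #|J| = #|W :\: Q| + #|U|.
  by rewrite /J cardsU; move: dis; rewrite -setI_eq0 => /eqP->; rewrite cards0 subn0.
have nJ : n %| s J.
  by rewrite -/J in sJ; rewrite sJ /dvdn -modnDmr -QU modnDmr addnC -sW.
rewrite -/J in sJ; split=> [|cU].
  by have := W_card nJ; rewrite cJ; clear -cW cQ; lia.
have cJW : #|J| = #|W| by clear -cW cJ cU cQ; lia.
by have := W_sum nJ cJW; clear -sW sJ; lia.
Qed.

Lemma W_compl J : J \subset ~: W -> n %| s J -> J = set0.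
Proof.
move=> JW nJ; have [|cJ _] := @exchange set0 J (sub0set _) JW.
  by rewrite big_set0 mod0n; apply/esym/eqP.
by apply/eqP; rewrite -cards_eq0; move: cJ; rewrite cards0; lia.
Qed.

Lemma sumW : s W <= (c - 1) * n.
Proof.
have := free W_dvd; case/dvdnP: W_dvd => q ->.
by rewrite ltn_mul2r leq_mul2r; lia.
Qed.

Lemma ones_W : 2 * #|W| <= s W + #|W :&: ones|.
Proof.
have := @card_eq1_ge _ t W (fun i _ => t_gt0 i).
by have -> : [set i in W | t i == 1] = W :&: ones by apply/setP => i; rewrite !inE.
Qed.

Lemma card_compl : #|W| + #|~: W| = #|I|.
Proof. by rewrite cardsC. Qed.

(** With [ones_W], this yields at least [2 * (n - 1) - 2 * #|~: W|] ones in [W], and one more for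
    odd [n]. *)
Lemma longW : s W + 2 * (n - 1) <= 2 * #|~: W| + 2 * #|W| /\
  (odd n -> s W + 2 * (n - 1) < 2 * #|~: W| + 2 * #|W|).
Proof.
have h2 := sumW; have h3 := card_compl.
have : (c + 1) * n = (c - 1) * n + 2 * n by rewrite -mulnDl; congr (_ * n); lia.
by split=> [|/long_odd]; lia.
Qed.

Lemma sum_lt_short_compl : 2 * #|~: W| <= n -> s setT < c * n.
Proof.
move=> tn; have [lW lWodd] := longW; have oW := ones_W.
have oo : #|W :&: ones| <= #|ones| by rewrite subset_leq_card ?subsetIr.
have [?|few] := leqP n (#|ones| + 1); first exact: sum_lt_of_ones.
(* There are at least [n - 2] ones, and at least [n - 1] for odd [n]; what remains is [n] even with
   exactly [n - 2] ones. *)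
have nE : ~~ odd n by apply/negP => /[dup] /lWodd; lia.
have onesE : #|ones| = n - 2 by lia.
case: (boolP [exists i, t i == 2]) => [/existsP[i /eqP ti]|no2].
  apply: sum_lt_of_residues => r rn.
  have [r_small|r_big] := leqP r #|ones|.
    by have [J Jo cJ] := exists_subset_card r_small; exists J; rewrite sum_ones.
  (* Only [r = n - 1] is missed by the ones; it is 2 plus [n - 3] ones. *)
  have [|J Jo cJ] := @exists_subset_card ones (r - 2); first by lia.
  exists (i |: J); rewrite big_setU1 ?sum_ones //=; first by lia.
  by apply/negP => /(subsetP Jo); rewrite inE ti.
(* Without a 2, the terms of [W] other than ones are at least 3. With [2 * #|W| >= s W + n - 2] and
   [#|W| <= s W] this leaves only [s W = n - 2], not a multiple of [n]. *)
have : 3 * #|W| <= s W + 2 * #|W :&: ones|.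
  have := cardsID ones W; rewrite (sum_setID t (subsetIl W ones)).
  rewrite sum_ones ?subsetIr // setDIr setDv set0U.
  have : 3 * #|W :\: ones| <= s (W :\: ones); last by lia.
  rewrite mulnC -sum_nat_const leq_sum // => i; rewrite !inE => /andP[ti _].
  move: no2; rewrite negb_exists => /forallP/(_ i).
  by have := t_gt0 i; lia.
have cWs : #|W| <= s W by apply: card_leq_sum.
move=> ge3; have sW : s W = n - 2 by lia.
by have := dvdn_leq _ W_dvd; rewrite sW; lia.
Qed.

Section LongCompl.
Hypothesis long_compl : n < 2 * #|~: W|.
Variables (g : 'Z_n) (x : I -> nat).
Hypothesis g_order : has_order g n.
Hypothesis x_gt0 : forall i, i \in ~: W -> 0 < x i.
Hypothesis t_eq : forall i, i \in ~: W -> (t i)%:R%R = (g *+ x i)%R.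
Hypothesis x_sum : \sum_(i in ~: W) x i < n.

Let n_gt1 : 1 < n. Proof. by lia. Qed.
Local Notation xs J := (\sum_(i in J) x i).
Let X1 := [set i in ~: W | x i == 1].

Lemma sum_natrE U : U \subset ~: W -> ((s U)%:R = g *+ xs U)%R.
Proof.
move=> UW; rewrite natr_sum -sumrMnr; apply: eq_bigr => i /(subsetP UW).
exact: t_eq.
Qed.

Lemma card_X1 : 2 * #|~: W| <= xs (~: W) + #|X1|.
Proof. exact: card_eq1_ge. Qed.

Lemma exists_X1 : exists2 i, i \in ~: W & x i = 1.
Proof.
have /card_gt0P[i] : 0 < #|X1| by have := card_X1; lia.
by rewrite inE => /andP[iW /eqP xi]; exists i.
Qed.

Lemma exchange_mulrn Q U : Q \subset W -> U \subset ~: W ->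
  ((s Q)%:R = g *+ xs U)%R -> #|U| <= #|Q| /\ (#|U| = #|Q| -> s U <= s Q).
Proof.
move=> QW UW e; apply: exchange => //; apply/eqP.
by rewrite -natr_Zn_eq // e sum_natrE.
Qed.

(* Otherwise [w] could be exchanged for at least two terms outside [W]. *)
Lemma W_residue w j : w \in W -> ((t w)%:R = g *+ j)%R -> 1 < j ->
  xs (~: W) < j.
Proof.
move=> wW tw j_gt1; rewrite ltnNge; apply/negP => jS.
(* Setting aside a term of coefficient 1 leaves [j - 1 > 0] to be filled by others, so at least two
   terms replace [w]. *)
have [i iW xi] := exists_X1; have cB := cardsD1 i (~: W); rewrite iW in cB.
have sB := sum_setD1 x iW.
have [|||J JB xJ] := @subset_sums_interval _ x (~: W :\ i) (j - 1); try by lia.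
  by move=> k /setD1P[_ /x_gt0].
have iJ : i \notin J by apply/negP => /(subsetP JB); rewrite !inE eqxx.
have [|||] := @exchange_mulrn [set w] (i |: J); rewrite ?sub1set //.
- by rewrite subUset sub1set iW (subset_trans JB) ?subD1set.
- by rewrite big_set1 big_setU1 //= xJ xi tw; congr (_ *+ _)%R; lia.
rewrite cards1 cardsU1 iJ => cJ _.
have J0 : J = set0 by apply/eqP; rewrite -cards_eq0; lia.
by rewrite J0 big_set0 in xJ; lia.
Qed.

Lemma card_compl_le : #|~: W| <= xs (~: W).
Proof. exact: card_leq_sum. Qed.

(* If [1 = - i g] with [i > 0] small, then [q] ones of [W] could be exchanged
   for all but few of the terms outside [W], where [q] is about [(n - S) / i]
   for the sum [S] of the coefficients outside [W]. *)
Lemma one_residue w j : w \in W -> t w = 1 -> (1 = g *+ j)%R -> j < n -> j = 1.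
Proof.
move=> wW tw jE jn; set S := xs (~: W).
have St := card_compl_le; rewrite -/S in St.
have j0 : j != 0.
  apply: contra_eqN jE => /eqP->; rewrite mulr0n (natr_Zn_eq0 n_gt1 1).
  by rewrite dvdn1; lia.
have jS : 1 < j -> S < j by apply: (W_residue wW); rewrite tw.
apply/eqP; apply: contraT => j1; have {}jS : S < j by apply: jS; lia.
have [i ij] : exists i, i + j = n by exists (n - j); rewrite subnK // ltnW.
have [i0 iS] : 0 < i /\ i < n - S by clear -ij jn jS; lia.
(* The ceiling of [(n - S) / i], so that [q] ones amount to [g *+ (n - q * i)] with
   [S - i < n - q * i <= S]. The bound on [i + q] follows from [(i - 1) * (q - 2) >= 0] and
   [(q - 1) * i < n - S]. *)
pose q := (n - S - 1) %/ i + 1.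
have [q_ge q_le iq] : [/\ n - S <= q * i, q * i < n - S + i & i + q <= n - S + 1].
  have := divn_eq (n - S - 1) i; have := ltn_pmod (n - S - 1) i0.
  have : 0 < (n - S - 1) %/ i by rewrite divn_gt0 //; clear -iS; lia.
  rewrite /q mulnDl mul1n; move: ((n - S - 1) %/ i) => p p0 rlt pE.
  have : i + p <= p * i + 1 by move: i0 p0; clear; nia.
  by clear -rlt pE iS; split; lia.
have [lW _] := longW; have oW := ones_W; have xT : S < n by [].
(* [W] has at least [2 * (n - S) - 2] ones, and this is at least [n - S >= q] because
   [n - S >= 2]. *)
have [|Q Qo cQ] := @exists_subset_card (W :&: ones) q.
  by clear -lW oW iq i0 St xT iS; lia.
have [||V VW xV] := @subset_sums_interval _ x (~: W) (S - (n - q * i)) x_gt0.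
- by rewrite -/S; clear -xT long_compl; lia.
- by rewrite -/S leq_subr.
have cV : #|V| <= xs V by apply: card_leq_sum => k /(subsetP VW)/x_gt0.
have cU := cardsD (~: W) V; have /setIidPr IV := VW; rewrite IV in cU.
have sU := sum_setID x VW; rewrite -/S in sU.
have qin : q * i < n by clear -q_le iS iq St xT long_compl; lia.
have xU : xs (~: W :\: V) = n - q * i by clear -sU xV q_ge qin xT; lia.
have sQ : s Q = q by rewrite sum_ones // (subset_trans Qo) ?subsetIr.
have [|||cUQ _] := @exchange_mulrn Q (~: W :\: V).
- by rewrite (subset_trans Qo) ?subsetIl.
- exact: subsetDl.
- rewrite sQ xU jE -mulrnA; apply: (@addIr _ (g *+ (q * i))%R).
  rewrite -!mulrnDr subnK ?(ltnW qin) //.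
  have -> : j * q + q * i = n * q by rewrite -ij mulnDl addnC (mulnC q).
  by rewrite mulrnA mulrn_Zn // mul0rn.
(* [V] has at most [i - 1] elements, so the exchange gives [#|~: W| <= q + i - 1 <= n - S], whereas
   [S >= #|~: W| > n / 2]. *)
by move: cUQ; rewrite cU cQ; clear -cV xV q_le q_ge iq iS St xT long_compl; lia.
Qed.

Lemma sum_lt_long_compl : s setT < c * n.
Proof.
have [lW lWodd] := longW; have oW := ones_W; have St := card_compl_le.
have [W0|/card_gt0P[w]] := posnP #|W :&: ones|; last first.
  rewrite !inE => /andP[wW /eqP tw].
  have [j jn jE] := has_order_gen n_gt1 (1%R : 'Z_n) g_order.
  have j1 := one_residue wW tw jE jn; rewrite j1 in jE.
  (* A term of coefficient 1 is congruent to [w] and may replace it; by the maximal sum of [W] it is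
     at most 1. *)
  have X1o : X1 \subset ones.
    apply/subsetP => i; rewrite !inE => /andP[iW /eqP xi].
    have [|||_] := @exchange_mulrn [set w] [set i]; rewrite ?sub1set ?inE //.
      by rewrite !big_set1 tw xi.
    by rewrite !cards1 !big_set1 tw => /(_ erefl); have := t_gt0 i; lia.
  apply: sum_lt_of_ones; have cX := card_X1.
  have : #|(W :&: ones) :|: X1| <= #|ones|.
    by rewrite subset_leq_card // subUset subsetIr.
  rewrite cardsU; have -> : W :&: ones :&: X1 = set0.
    by apply/setP => i; rewrite !inE; case: (i \in W); rewrite ?andbF.
  by rewrite cards0; lia.
(* Without ones in [W], [longW] forces [#|~: W| = n - 1] and then [s W = 2 * #|W|], so [W] consists
   of twos. By [W_residue] this gives [g = 2], which for even [n] does not have order [n]. *)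
have nE : ~~ odd n by apply/negP => /[dup] /lWodd; lia.
have [cc W_gt0] : #|~: W| = n - 1 /\ 0 < #|W|.
  have := card_compl; have : 3 * n <= (c + 1) * n by rewrite leq_mul2r; lia.
  by lia.
have /card_gt0P[w wW] := W_gt0.
have ge2 i : i \in W -> 2 <= t i.
  move=> iW; have := t_gt0 i; move/eqP: W0; rewrite cards_eq0 => /eqP/setP/(_ i).
  by rewrite !inE iW /=; lia.
have tw : t w = 2.
  have := sum_setD1 t wW; have := cardsD1 w W; rewrite wW.
  have : 2 * #|W :\ w| <= s (W :\ w).
    by rewrite mulnC -sum_nat_const leq_sum // => i /setD1P[_ /ge2].
  by have := ge2 w wW; lia.
have [j jn jE] := has_order_gen n_gt1 (2%:R%R : 'Z_n) g_order.
have j_le1 : j <= 1.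
  by rewrite leqNgt; apply/negP => /(@W_residue w j wW); rewrite tw => /(_ jE); lia.
case: j => [|[|//]] in jn jE j_le1.
  by move/eqP: jE; rewrite mulr0n natr_Zn_eq0 // => /dvdn_leq; lia.
have : (g *+ n./2 != 0)%R by apply: has_order_neq0 => //; lia.
rewrite -[g]mulr1n -jE -mulrnA natr_Zn_eq0 //.
have -> : 2 * n./2 = n by lia.
by rewrite dvdnn.
Qed.

End LongCompl.

End Optimal.

Theorem long_sum_lt : s setT < c * n.
Proof.
have [W [W_dvd W_card W_sum]] := exists_optimal.
have [short|long_compl] := leqP (2 * #|~: W|) n.
  exact: (sum_lt_short_compl W_dvd).
have n_gt1 : 1 < n by lia.
have [||g [x [og xE xS]]] := @savchev_chen_Zn n n_gt1 I t (~: W).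
- exact: W_compl W_card W_sum.
- by [].
by apply: (sum_lt_long_compl W_dvd W_card W_sum long_compl og _ _ xS) => i /xE[].
Qed.

End LongSequences.

(** * Subsequence sums and smoothness *)

(** A computable list, so that small moduli can be settled by evaluation. *)
Fixpoint nsums (s : seq nat) : seq nat :=
  if s is a :: s' then nsums s' ++ a :: map (addn a) (nsums s') else [::].

Implicit Types (s U : seq nat) (a x l m : nat).

Lemma nsumsP s x :
  reflect (exists U : seq nat, [/\ subseq U s, U != [::] & sumn U = x]) (x \in nsums s).
Proof.
elim: s x => [|a s IHs] x /=.
  by constructor=> -[U []]; case: U.
rewrite mem_cat inE; apply: (iffP or3P) => [[/IHs[U [Us U0 Ux]]|/eqP->|/mapP[y /IHs[U [Us U0 Uy]] ->]]|].
- by exists U; split=> //; apply: subseq_trans Us (subseq_cons _ _).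
- by exists [:: a]; rewrite /= eqxx addn0 sub0seq.
- by exists (a :: U); rewrite /= eqxx Us Uy.
case=> -[|b U] [] //=; case: (eqVneq b a) => [->|ba] Us _ <-.
  have [->|U0] := eqVneq U [::]; first by constructor 2; rewrite /= addn0.
  constructor 3; apply: map_f; apply/IHs; exists U; split=> //.
by constructor 1; apply/IHs; exists (b :: U).
Qed.

Lemma nsums_subseq s U x : subseq U s -> x \in nsums U -> x \in nsums s.
Proof.
by move=> Us /nsumsP[V [VU V0 Vx]]; apply/nsumsP; exists V; rewrite (subseq_trans VU Us).
Qed.

Lemma nsums_sumn s : s != [::] -> sumn s \in nsums s.
Proof. by move=> s0; apply/nsumsP; exists s. Qed.

Lemma nsums_gt0 s x : all (leq 1) s -> x \in nsums s -> 0 < x.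
Proof.
elim: s x => //= a s IHs x /andP[a0 /IHs{}IHs].
rewrite mem_cat inE => /or3P[/IHs|/eqP->|/mapP[y _ ->]] //; lia.
Qed.

Lemma nsums_le s x : x \in nsums s -> x <= sumn s.
Proof.
elim: s x => //= a s IHs x; rewrite mem_cat inE.
by case/or3P => [/IHs|/eqP->|/mapP[y /IHs ? ->]]; lia.
Qed.

Lemma nsums_perm s s' : perm_eq s s' -> nsums s =i nsums s'.
Proof.
have H u v x : perm_eq u v -> x \in nsums u -> x \in nsums v.
  move=> uv /nsumsP[U [Uu U0 Ux]].
  have /count_subseqP[V Vv UV] : forall y, count_mem y U <= count_mem y v.
    by move=> y; rewrite -(permP uv); move: y; apply/count_subseqP; exists U.
  apply/nsumsP; exists V; rewrite Vv -(perm_sumn UV) -size_eq0 -(perm_size UV) size_eq0.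
  by rewrite U0.
by move=> ss' x; apply/idP/idP; apply: H; rewrite // perm_sym.
Qed.

(** Passes from subsequences to sets of positions, the setting of the results above on families
    indexed by a finite type. *)
Lemma nsums_index s x : x \in nsums s <->
  exists2 J : {set 'I_(size s)}, J != set0 & \sum_(i in J) nth 0 s i = x.
Proof.
elim: s x => [|a s IHs] x /=.
  split=> // -[J /set0Pn[[]]] //.
have split_sum (J : {set 'I_(size s).+1}) :
    \sum_(i in J) nth 0 (a :: s) i =
    (ord0 \in J) * a + \sum_(i in [set i | lift ord0 i \in J]) nth 0 s i.
  rewrite big_mkcond big_ord_recl /=; congr (_ + _).
    by case: ifP; rewrite ?mul1n.
  by rewrite [RHS]big_mkcond; apply: eq_bigr => i _; rewrite inE.
pose up (b : bool) (J : {set 'I_(size s)}) : {set 'I_(size s).+1} :=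
  [set i | if unlift ord0 i is Some j then j \in J else b].
have upE b J : \sum_(i in up b J) nth 0 (a :: s) i = b * a + \sum_(i in J) nth 0 s i.
  rewrite split_sum /up inE unlift_none; congr (_ + _); apply: eq_bigl => i.
  by rewrite !inE liftK.
have up0 b J : b || (J != set0) -> up b J != set0.
  case/orP => [b1|/set0Pn[i iJ]]; apply/set0Pn.
    by exists ord0; rewrite inE unlift_none.
  by exists (lift ord0 i); rewrite inE liftK.
rewrite mem_cat inE; split.
  case/or3P => [/IHs[J J0 <-]|/eqP->|/mapP[y /IHs[J J0 <-] ->]].
  - by exists (up false J); rewrite ?up0 ?upE ?J0 ?orbT.
  - by exists (up true set0); rewrite ?up0 ?upE ?big_set0 ?mul1n ?addn0.
  - by exists (up true J); rewrite ?up0 ?upE ?mul1n.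
case=> J J0; rewrite split_sum; set K := [set i | _] => <-.
have [K0|K0] := eqVneq K set0.
  suff -> : ord0 \in J by rewrite mul1n K0 big_set0 addn0 eqxx orbT.
  have /set0Pn[i iJ] := J0; case: (unliftP ord0 i) iJ => [j ->|-> //] jJ.
  by move/setP: K0 => /(_ j); rewrite !inE jJ.
have Ks : \sum_(i in K) nth 0 s i \in nsums s by apply/IHs; exists K.
by case: (ord0 \in J); rewrite ?mul1n ?mul0n ?add0n ?Ks ?(map_f _ Ks) ?orbT.
Qed.

Lemma sumn_index s : \sum_(i : 'I_(size s)) nth 0 s i = sumn s.
Proof. by rewrite sumnE [RHS](big_nth 0) big_mkord. Qed.

Lemma nsums_interval s m : all (leq 1) s -> sumn s < 2 * size s ->
  0 < m <= sumn s -> m \in nsums s.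
Proof.
move=> s_gt0 ss /andP[m0 ms]; apply/nsums_index.
have [|||J _ Jm] :=
  @subset_sums_interval _ (fun i : 'I_(size s) => nth 0 s i) setT m.
- by move=> i _; apply: (all_nthP 0 s_gt0).
- by rewrite cardsT card_ord (eq_bigl predT) ?sumn_index // => i; rewrite inE.
- by rewrite (eq_bigl predT) ?sumn_index // => i; rewrite inE.
by exists J => //; apply: contraTneq m0 => J0; rewrite -Jm J0 big_set0.
Qed.

Lemma size_leq_sumn s : all (leq 1) s -> size s <= sumn s.
Proof. by elim: s => //= a s IHs /andP[a0 /IHs]; lia. Qed.

Lemma mem1_sumn s : all (leq 1) s -> 1 <= size s -> sumn s < 2 * size s -> 1 \in s.
Proof.
move=> + _; elim: s => //= a s IHs /andP[a0 /[dup] /IHs{}IHs sp] ss.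
rewrite inE; have [//|a1 /=] := eqVneq 1 a; apply: IHs; lia.
Qed.

Definition idem_free k n (s : seq nat) := forall x : nat, x \in nsums s -> k <= x -> ~~ (n %| x).

Definition min_idem k n (s : seq nat) := [/\ s != [::], k <= sumn s, n %| sumn s &
  forall U : seq nat, subseq U s -> size U < size s -> idem_free k n U].

(** The clause [1 \in s] rules out the empty list, for which the other clause is vacuous. *)
Definition interval_sums (s : seq nat) :=
  1 \in s /\ forall m : nat, 0 < m <= sumn s -> m \in nsums s.

Local Open Scope ring_scope.

Section SmoothShape.
Variable G : zmodType.
Implicit Types (g : G) (T : seq G).

Lemma sums_to_zmodE T (y : G) : sums_to T y <-> T != [::] /\ y = \sum_(a <- T) a.
Proof.
case: T => [|a T] /=; first by split=> // -[].
have -> : foldl +%R a T = a + \sum_(b <- T) b.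
  elim: T a => [|b T IHT] a /=; first by rewrite big_nil addr0.
  by rewrite IHT big_cons addrA.
by rewrite big_cons; split=> [<-|[]].
Qed.

Lemma sum_mulrn g (s : seq nat) : \sum_(a <- [seq g *+ x | x <- s]) a = g *+ sumn s.
Proof. by rewrite big_map sumnE sumrMnr. Qed.

Lemma SigmaE g (s : seq nat) (y : G) :
  Sigma [seq g *+ x | x <- s] y <-> exists2 v, v \in nsums s & y = g *+ v.
Proof.
split=> [[U Us /sums_to_zmodE[U0 ->]]|[v /nsumsP[U [Us U0 <-]] ->]].
  have [m ms Um] := subseqP Us.
  exists (sumn (mask m s)); last by rewrite Um -map_mask sum_mulrn.
  apply/nsumsP; exists (mask m s); rewrite mask_subseq; split=> //.
  by move: U0; rewrite Um -map_mask; case: (mask m s).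
exists [seq g *+ x | x <- U]; first exact: map_subseq.
by apply/sums_to_zmodE; rewrite sum_mulrn; case: (U) U0.
Qed.

Lemma smooth_shapeI g (s : seq nat) : all (leq 1) s -> interval_sums s ->
  smooth_shape g [seq g *+ x | x <- s] (sumn s).
Proof.
move=> s_gt0 [s1 sI]; exists (sort leq s).
have ps : perm_eq (sort leq s) s by rewrite perm_sort.
have ss : sorted leq (sort leq s) by apply: sort_sorted leq_total _.
split=> //.
- by apply: perm_map; rewrite perm_sym.
- have s_gt0' : all (leq 1) (sort leq s) by rewrite (perm_all _ ps).
  have : 1%N \in sort leq s by rewrite (perm_mem ps).
  case: (sort leq s) ss s_gt0' => //= a r ar /andP[a0 _].
  rewrite inE => /orP[/eqP<- //|r1].
  by have /allP/(_ _ r1) := order_path_min leq_trans ar; lia.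
- exact: perm_sumn.
apply: boolp.funext => y; apply: boolp.propext; split.
  case/SigmaE => v vs ->; exists v => //=.
  by rewrite (nsums_gt0 s_gt0 vs) nsums_le.
by case=> m /= mP <-; apply/SigmaE; exists m => //; apply: sI.
Qed.

(** The sorted coefficients of the definition are permuted back to the order of [T]. *)
Lemma smooth_shapeE g T N : smooth_shape g T N -> exists s : seq nat,
  [/\ T = [seq g *+ x | x <- s], 1%N \in s, all (leq 1) s, sumn s = N
    & forall m, (0 < m <= N)%N -> Sigma T (g *+ m)].
Proof.
case=> r [Tr r1 sr <- ST].
have [Is pI TE] := perm_iotaP 0 Tr; rewrite size_map in pI.
have pr : perm_eq (map (nth 0%N r) Is) r.
  by rewrite -{2}(mkseq_nth 0%N r) /mkseq perm_map.
exists (map (nth 0%N r) Is); split.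
- rewrite TE -map_comp; apply/eq_in_map => i; rewrite (perm_mem pI) mem_iota => ir.
  by rewrite /= (nth_map 0%N).
- by rewrite (perm_mem pr); case: (r) r1 => //= a r' ->; rewrite mem_head.
- rewrite (perm_all _ pr); case: (r) r1 sr => //= a r' -> pr'.
  exact: order_path_min leq_trans pr'.
- exact: perm_sumn.
by move=> m mP; rewrite ST; exists m.
Qed.

End SmoothShape.

Lemma smooth_intE (s : seq nat) : all (leq 1) s ->
  smooth (1 : int) [seq x%:Z | x <- s] <-> interval_sums s.
Proof.
move=> s_gt0; have e : [seq x%:Z | x <- s] = [seq 1 *+ x | x <- s].
  by apply: eq_map => x; rewrite natz.
split=> [[N /smooth_shapeE[r [sr r1 r0 <- SI]] _]|sI].
  have rs : s = r.
    have z_inj : injective (fun x : nat => x%:Z) by move=> a b [].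
    by apply: (inj_map z_inj); rewrite sr; apply: eq_map => x; rewrite natz.
  rewrite -rs in r1 SI; split=> // m /SI; rewrite e => /SigmaE[v vs].
  by rewrite !natz => -[->].
exists (sumn s); first by rewrite e; apply: smooth_shapeI.
by move=> j /andP[j0 _]; rewrite natz; case: j j0.
Qed.

Local Close Scope ring_scope.

(** * Sequences over the cyclic semigroup *)

Lemma least_posP (P : nat -> Prop) u : 0 < u -> P u ->
  [/\ 0 < least_pos P <= u, P (least_pos P)
    & forall m, 0 < m -> P m -> least_pos P <= m].
Proof.
move=> u0 Pu; have ex : exists m, (0 < m) && boolp.asbool (P m).
  by exists u; rewrite u0; apply/boolp.asboolP.
case: (ex_minnP ex) => l /andP[l0 /boolp.asboolP Pl] lmin.
have lP : [/\ 0 < l, P l & forall m, 0 < m -> P m -> l <= m].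
  by split=> // m m0 Pm; apply: lmin; rewrite m0; apply/boolp.asboolP.
rewrite /least_pos; case: classical_sets.xgetP => [m _ [m0 Pm mmin]|/(_ l)//].
by split; rewrite // m0 mmin.
Qed.

Lemma least_pos_eq (P : nat -> Prop) u : 0 < u -> P u ->
  (forall m, 0 < m -> P m -> u <= m) -> least_pos P = u.
Proof.
move=> u0 Pu umin; have [/andP[l0 lu] Pl _] := least_posP u0 Pu.
by apply/eqP; rewrite eqn_leq lu umin.
Qed.

Section CyclicSemigroup.
Variables (k n : nat).
Hypotheses (k0 : 0 < k) (n0 : 0 < n).
Local Open Scope ring_scope.

Lemma foldl_csg (a : csg k n) (U : seq (csg k n)) :
  val (foldl +%R a U) = csg_red k n (val a + sumn (map val U)).
Proof.
elim: U a => [|b U IHU] a /=.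
  rewrite addn0 csg_red_id //; have /andP[_] := csg_valP a.
  by rewrite !prednK.
by rewrite IHU /= !prednK // csg_redDl addnA.
Qed.

Lemma sums_to_csgE T (x : csg k n) :
  sums_to T x <-> T != [::] /\ val x = csg_red k n (sumn (map val T)).
Proof.
case: T => [|a T] /=; first by split=> // -[].
by rewrite -foldl_csg; split=> [->|[_ /val_inj]].
Qed.

Lemma idempotent_csgE (e : csg k n) m : (0 < m)%N -> val e = csg_red k n m ->
  idempotent_elt e <-> (k <= m)%N && (n %| m)%N.
Proof.
move=> m0 em; have -> : idempotent_elt e <-> csg_red k n (m + m) = csg_red k n m.
  have -> : csg_red k n (m + m) = val (e + e).
    by rewrite /= !prednK // em csg_redDl addnC csg_redDl.
  by rewrite -em; split=> [->|/val_inj].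
rewrite /csg_red; have [km|km] /= := leqP k m; last by split=> //; case: ifP; lia.
rewrite ltnNge (leq_trans km (leq_addr _ _)) /=.
apply: (iff_trans (rwP eqP)); rewrite eqn_add2l.
have -> : (m + m - k = (m - k) + m)%N by lia.
by rewrite -[X in _ == X %[mod _]]addn0 eqn_modDl mod0n.
Qed.

Lemma exists_csg m : (0 < m)%N -> exists e : csg k n, val e = csg_red k n m.
Proof. by move=> m0; exists (csg_of k n m0); rewrite /= !prednK. Qed.

Lemma map_val_gt0 (T : seq (csg k n)) : all (leq 1) (map val T).
Proof. by apply/allP => _ /mapP[a _ ->]; have /andP[] := csg_valP a. Qed.

Lemma idem_sum_freeE (T : seq (csg k n)) :
  idem_sum_free T <-> idem_free k n (map val T).
Proof.
split=> [Tfree x xT kx|Tfree e [U UT /sums_to_csgE[U0 eU]]].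
  have x0 := nsums_gt0 (map_val_gt0 T) xT; have [e ex] := exists_csg x0.
  apply/negP => nx; apply: (Tfree e); last by apply/(idempotent_csgE x0 ex); rewrite kx.
  case/nsumsP: xT => V [/subseqP[m ms Vm] V0 Vx].
  exists (mask m T); first exact: mask_subseq.
  apply/sums_to_csgE; rewrite map_mask -Vm Vx; split=> //.
  by apply: contraNneq V0 => m0; rewrite Vm -map_mask m0.
have Ux : sumn (map val U) \in nsums (map val T).
  by apply/nsumsP; exists (map val U); rewrite map_subseq //; case: (U) U0.
have U_gt0 := nsums_gt0 (map_val_gt0 T) Ux.
by move/(idempotent_csgE U_gt0 eU)/andP => [/(Tfree _ Ux)/negP].
Qed.

Lemma min_idem_sumE (T : seq (csg k n)) :
  min_idem_sum T <-> min_idem k n (map val T).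
Proof.
have sub : (forall (U : seq (csg k n)) (x : csg k n), subseq U T -> (size U < size T)%N -> sums_to U x ->
     ~ idempotent_elt x) <->
  (forall U : seq nat, subseq U (map val T) -> (size U < size (map val T))%N -> idem_free k n U).
  split=> [H U /subseqP[m ms ->]|H U x UT sUT Ux].
    rewrite -map_mask !size_map => sU; apply/idem_sum_freeE => x [V VU Vx].
    apply: (H V) => //; first by apply: subseq_trans VU (mask_subseq _ _).
    exact: leq_ltn_trans (size_subseq VU) sU.
  have /idem_sum_freeE : idem_free k n (map val U).
    by apply: H; rewrite ?size_map ?map_subseq.
  by apply; exists U.
rewrite /min_idem_sum sub; split=> [[[e /sums_to_csgE[T0 eT] ie] H]|[T0 kT nT H]].
  have T_gt0 : (0 < sumn (map val T))%N.
    by apply: (nsums_gt0 (map_val_gt0 T)); apply: nsums_sumn; case: (T) T0.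
  by have /andP[] := iffLR (idempotent_csgE T_gt0 eT) ie; split=> //; case: (T) T0.
split=> //; have T_gt0 : (0 < sumn (map val T))%N.
  by apply: (nsums_gt0 (map_val_gt0 T)); apply: nsums_sumn.
have [e ex] := exists_csg T_gt0; exists e.
  by apply/sums_to_csgE; split=> //; case: (T) T0.
by apply/(idempotent_csgE T_gt0 ex); rewrite kT.
Qed.

Definition in_range (s : seq nat) := all (fun x => 0 < x < k + n)%N s.

Lemma in_range_csg s : in_range s <-> exists T : seq (csg k n), map val T = s.
Proof.
split=> [|[T <-]]; last first.
  apply/allP => _ /mapP[a _ ->]; have /andP[a0 aM] := csg_valP a.
  by rewrite a0 (leq_trans aM) // !prednK.
elim: s => [_|x s IHs /andP[xP /IHs[T <-]]]; first by exists [::].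
have xP' : (0 < x < k.-1.+1 + n.-1.+1)%N by rewrite !prednK.
by exists (Csg xP' :: T).
Qed.

Lemma in_range_gt0 s : in_range s -> all (leq 1) s.
Proof. by apply: sub_all => x /andP[]. Qed.

Lemma csg_seqs_nat (P : seq (csg k n) -> Prop) (Q R : seq nat -> Prop) l :
  (forall T, P T <-> Q (map val T)) ->
  (forall T, P T -> (l <= size T)%N -> R (map val T)) <->
  (forall s, in_range s -> Q s -> (l <= size s)%N -> R s).
Proof.
move=> PQ; split=> [H s /in_range_csg[T <-] /PQ PT|H T PT lT].
  by rewrite size_map; apply: H.
by apply: H; [apply/in_range_csg; exists T | apply/PQ | rewrite size_map].
Qed.

Lemma map_ind (T : seq (csg k n)) : map (@ind k n) T = map val T.
Proof. by apply: eq_map => a; rewrite indE. Qed.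

Lemma hSmo_ltE : (n < k)%N -> hSmo k n = least_pos (fun l => forall s,
  in_range s -> idem_free k n s -> (l <= size s)%N -> interval_sums s).
Proof.
move=> nk; rewrite /hSmo nk ifF; last by lia.
congr least_pos; apply: boolp.funext => l; apply: boolp.propext.
rewrite -(@csg_seqs_nat (@idem_sum_free _) _ _ l idem_sum_freeE).
by split=> H T TF lT; move: (H T TF lT);
  rewrite -(smooth_intE (map_val_gt0 T)) -map_ind -map_comp.
Qed.

Lemma Smo_ltE : (n < k)%N -> Smo k n = least_pos (fun l => forall s,
  in_range s -> min_idem k n s -> (l <= size s)%N -> interval_sums s).
Proof.
move=> nk; rewrite /Smo nk ifF; last by lia.
congr least_pos; apply: boolp.funext => l; apply: boolp.propext.
rewrite -(@csg_seqs_nat (@min_idem_sum _) _ _ l min_idem_sumE).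
by split=> H T TF lT; move: (H T TF lT);
  rewrite -(smooth_intE (map_val_gt0 T)) -map_ind -map_comp.
Qed.

Lemma hSmo_leE : (k <= n)%N -> (1 < n)%N -> hSmo k n = least_pos (fun l => forall s,
  in_range s -> idem_free k n s -> (l <= size s)%N ->
  exists2 g : 'Z_n, has_order g n & smooth g [seq x%:R | x <- s]).
Proof.
move=> kn n1; rewrite /hSmo ltnNge kn ifF /=; last by lia.
congr least_pos; apply: boolp.funext => l; apply: boolp.propext.
rewrite -(@csg_seqs_nat (@idem_sum_free _) _ (fun s =>
  exists2 g : 'Z_n, has_order g n & smooth g [seq x%:R | x <- s]) l idem_sum_freeE).
by split=> H T TF lT; move: (H T TF lT); rewrite -map_ind -map_comp.
Qed.

Lemma Smo_leE : (k <= n)%N -> (1 < n)%N -> Smo k n = least_pos (fun l => forall s,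
  in_range s -> min_idem k n s -> (l <= size s)%N ->
  exists2 g : 'Z_n, has_order g n & zero_sum_smooth g [seq x%:R | x <- s]).
Proof.
move=> kn n1; rewrite /Smo ltnNge kn ifF /=; last by lia.
congr least_pos; apply: boolp.funext => l; apply: boolp.propext.
rewrite -(@csg_seqs_nat (@min_idem_sum _) _ (fun s =>
  exists2 g : 'Z_n, has_order g n & zero_sum_smooth g [seq x%:R | x <- s]) l min_idem_sumE).
by split=> H T TF lT; move: (H T TF lT); rewrite -map_ind -map_comp.
Qed.

End CyclicSemigroup.

(** * Index greater than the period *)

Lemma size_neq_nil s : 0 < size s -> s != [::].
Proof. by case: s. Qed.

Lemma nsums_cons2 a s x : x \in nsums (a :: s) ->
  [\/ x \in nsums s, x = a | exists2 y, y \in nsums s & x = a + y].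
Proof.
rewrite /= mem_cat inE => /or3P[xs|/eqP->|/mapP[y ys ->]].
- by constructor 1.
- by constructor 2.
by constructor 3; exists y.
Qed.

Lemma nsums_all2 s x : all (pred1 2) s -> x \in nsums s ->
  ~~ odd x /\ x <= 2 * size s.
Proof.
elim: s x => // a s IHs x /andP[/eqP-> /IHs{}IHs] /nsums_cons2[/IHs|->|[y /IHs]].
- by move=> [xo xs]; split=> //=; lia.
- by split=> //=; lia.
by move=> [yo ys] ->; split=> //=; lia.
Qed.

Lemma not_interval_sums s : 1 \notin s -> ~ interval_sums s.
Proof. by move=> s1 [/(negP s1)]. Qed.

Lemma idem_free_sum k n s : idem_free k n s -> n %| sumn s -> s != [::] -> sumn s < k.
Proof.
by move=> sF ns s0; rewrite ltnNge; apply: contraL ns; apply/sF/nsums_sumn.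
Qed.

Lemma sumn_rem x s : x \in s -> sumn s = x + sumn (rem x s).
Proof. by move=> xs; rewrite (perm_sumn (perm_to_rem xs)). Qed.

Lemma size_rem_lt x s : x \in s -> size s = (@size nat (rem x s)).+1.
Proof. by move=> xs; rewrite (perm_size (perm_to_rem xs)). Qed.

Lemma sumn_ge2 s : all (leq 2) s -> 2 * size s <= sumn s.
Proof. by elim: s => //= a s IHs /andP[a2 /IHs]; lia. Qed.

Lemma min_idem_rem k n s x : x \in s -> min_idem k n s -> idem_free k n (rem x s).
Proof.
by move=> xs [_ _ _]; apply; rewrite ?rem_subseq // (size_rem_lt xs).
Qed.

Lemma has_ge2 s : all (leq 1) s -> 1 \notin s -> all (leq 2) s.
Proof.
move=> /allP s1 n1; apply/allP => x xs; have := s1 x xs.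
by have [x1|x1] := eqVneq x 1; [move: n1; rewrite -x1 xs | lia].
Qed.

Section IndexGtPeriod.
Variables (k n : nat).
Hypotheses (n0 : 0 < n) (nk : n < k).
Local Notation c := (ceil_div k n).

Lemma ceil_div_bounds : [/\ k <= c * n, c * n < k + n & 1 < c].
Proof.
have := divn_eq (k + n.-1) n; have := ltn_pmod (k + n.-1) n0; rewrite -/(c).
move=> r_lt e; have kcn : k <= c * n by lia.
split=> //; first by lia.
rewrite ltnNge; apply/negP => c1.
have : c * n <= 1 * n by rewrite leq_mul2r c1 orbT.
lia.
Qed.

Lemma leq_idem x : n %| x -> (k <= x) = (c * n <= x).
Proof.
have [kc ck c1] := ceil_div_bounds; case/dvdnP => q ->.
apply/idP/idP; last by lia.
rewrite leq_mul2r => kq; apply/orP; right; rewrite leqNgt; apply/negP => qc.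
have : q.+1 * n <= c * n by rewrite leq_mul2r qc orbT.
by rewrite mulSn; lia.
Qed.

Lemma idem_freeE s : idem_free k n s <->
  forall x, x \in nsums s -> n %| x -> x < c * n.
Proof.
split=> sF x xs; first by move=> nx; rewrite ltnNge -leq_idem //; apply: contraL nx; apply: sF.
by move=> kx; apply/negP => nx; have := sF x xs nx; rewrite ltnNge -leq_idem ?kx.
Qed.

Lemma long_interval_sums s : in_range k n s -> idem_free k n s -> 2 < n ->
  (c + 1) * n <= 2 * size s + 2 -> (odd n -> (c + 1) * n <= 2 * size s + 1) ->
  interval_sums s.
Proof.
move=> /in_range_gt0 s_gt0 /idem_freeE sF n2 l l'; have [kc ck c1] := ceil_div_bounds.
have : sumn s < c * n.
  rewrite -sumn_index (eq_bigl (mem [set: 'I_(size s)])); last by move=> i; rewrite /= inE.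
  apply: (@long_sum_lt _ (fun i : 'I_(size s) => nth 0 s i)); rewrite ?card_ord //.
    by move=> i; apply: (all_nthP 0 s_gt0).
  move=> J nJ; have [->|J0] := eqVneq J set0; first by rewrite big_set0; lia.
  by apply: sF => //; apply/nsums_index; exists J.
(* Here [c * n <= 2 * size s + 2 - n] and [n >= 3]. *)
rewrite mulnDl mul1n in l => ss; have s2 : sumn s < 2 * size s by lia.
have s1 : 0 < size s by lia.
by split; [apply: mem1_sumn | move=> m; apply: nsums_interval].
Qed.

Definition hP l := forall s, in_range k n s -> idem_free k n s -> l <= size s ->
  interval_sums s.
Definition sP l := forall s, in_range k n s -> min_idem k n s -> l <= size s ->
  interval_sums s.

Lemma hP_ge3 l : 2 < n -> (c + 1) * n <= 2 * l + 2 ->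
  (odd n -> (c + 1) * n <= 2 * l + 1) -> hP l.
Proof. by move=> n2 l1 l2 s sr sF ls; apply: long_interval_sums => //; [lia|move=> /l2; lia]. Qed.

Lemma hP_1 l : n = 1 -> 0 < l -> k <= 2 * l -> hP l.
Proof.
move=> n1 l0 kl s /in_range_gt0 s_gt0 sF ls.
have s0 : s != [::] by case: (s) ls => //=; lia.
have := idem_free_sum sF; rewrite n1 dvd1n => /(_ isT s0) ss.
by split; [apply: mem1_sumn; lia | move=> m; apply: nsums_interval; lia].
Qed.

(** If the total is odd, removing an odd term leaves an even sum, at most [2 * c - 2]. If that term
    is a 1, the total is below [2 * (c + 1)]; without a 1, the remaining [c] or more terms already
    sum to [2 * c]. *)
Lemma hP_2 : n = 2 -> hP (c + 1).
Proof.
move=> n2 s sr /idem_freeE sF ls; have s_gt0 := in_range_gt0 sr.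
have [kc ck c1] := ceil_div_bounds; rewrite n2 in kc ck c1 sF ls.
have s1 : 0 < size s by lia.
suff ss : sumn s < 2 * size s.
  by split; [apply: mem1_sumn; lia | move=> m; apply: nsums_interval; lia].
have s0 := size_neq_nil s1.
have [so|se] := boolP (odd (sumn s)); last first.
  by have := sF _ (nsums_sumn s0); rewrite dvdn2 => /(_ se); lia.
rewrite ltnNge; apply/negP => ss.
have sub x : x \in s -> odd x -> sumn (rem x s) < ceil_div k 2 * 2.
  move=> xs xo; have e := sumn_rem xs; have ez := size_rem_lt xs.
  apply: sF; last by rewrite dvdn2; lia.
  by apply: (nsums_subseq (rem_subseq x s)); apply/nsums_sumn/size_neq_nil; lia.
have [x xs xo] : exists2 x, x \in s & odd x.
  apply/hasP; apply: contraLR so => /hasPn; elim: (s) => //= a r IHr H.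
  rewrite oddD negb_add (negPf (H a (mem_head _ _))) eq_sym eqbF_neg.
  by apply: IHr => b br; apply: H; rewrite inE br orbT.
have x_ge := sub x xs xo; have e := sumn_rem xs; have ez := size_rem_lt xs.
have s2 : all (leq 2) s.
  apply: has_ge2 => //; apply/negP => s_1.
  by have := sub 1 s_1 isT; have := sumn_rem s_1; lia.
have r2 : all (leq 2) (rem x s) by apply/allP => y /mem_rem; apply: (allP s2).
by have := sumn_ge2 r2; lia.
Qed.

(** One better than [sP_succ] applied to [hP_2]. If the total were at least twice the length, there
    would be two odd terms, not both 1, and the rest would be exactly [c - 1] twos; dropping one of
    these leaves an even sum of at least [2 * c]. *)
Lemma sP_2 : n = 2 -> sP (c + 1).
Proof.
move=> n2 s sr sM ls; have s_gt0 := in_range_gt0 sr.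
have [kc ck c1] := ceil_div_bounds; rewrite n2 in kc ck c1 ls.
have [s0 ks] := sM; rewrite n2 dvdn2 => se _.
have s1 : 0 < size s by lia.
suff ss : sumn s < 2 * size s.
  by split; [apply: mem1_sumn; lia | move=> m; apply: nsums_interval; lia].
rewrite ltnNge; apply/negP => ss.
have sub U : subseq U s -> size U < size s -> ~~ odd (sumn U) -> sumn U < ceil_div k 2 * 2.
  move=> Us sU; have [_ _ _ sF] := sM; have := sF U Us sU.
  rewrite idem_freeE n2 => UF; have [->|U0] := eqVneq U [::]; first by move=> _ /=; lia.
  by rewrite -dvdn2; apply/UF/nsums_sumn.
have find_odd r : odd (sumn r) -> exists2 x, x \in r & odd x.
  move=> ro; apply/hasP; apply: contraLR ro => /hasPn; elim: r => //= a r IHr H.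
  rewrite oddD negb_add (negPf (H a (mem_head _ _))) eq_sym eqbF_neg.
  by apply: IHr => b br; apply: H; rewrite inE br orbT.
have [x xs xo] : exists2 x, x \in s & odd x /\ (1 \in s -> x = 1).
  have [s_1|s_1] := boolP (1 \in s); first by exists 1.
  case: (boolP (has odd s)) => [/hasP[x xs xo]|/hasPn noodd]; first by exists x.
  have [y ys] : exists y, y \in s by case: (s) s0 => // a r _; exists a; rewrite mem_head.
  have e := sumn_rem ys; have ez := size_rem_lt ys; have yo := noodd y ys.
  have r2 : all (leq 2) (rem y s).
    by apply/allP => z /mem_rem; apply: (allP (has_ge2 s_gt0 s_1)).
  have := sub (rem y s) (rem_subseq _ _); have := sumn_ge2 r2; lia.
have e := sumn_rem xs; have ez := size_rem_lt xs.
have [y yr yo] : exists2 y, y \in rem x s & odd y by apply: find_odd; lia.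
have e' := sumn_rem yr; have ez' := size_rem_lt yr.
set r := rem y (rem x s) in e' ez'.
have rs : subseq r s by apply: subseq_trans (rem_subseq _ _) (rem_subseq _ _).
have x0 := allP s_gt0 x xs; have [{}xo x_1] := xo.
have r_lt : sumn r < ceil_div k 2 * 2.
  by apply: (sub r rs); [move: ez ez' | move: e e' se xo yo]; clear; lia.
have [x1|x1] := boolP (1 \in rem x s).
  have e1 := sumn_rem x1; have ez1 := size_rem_lt x1.
  have xE : x = 1 by apply: x_1; apply: mem_rem x1.
  have : sumn (rem 1 (rem x s)) < ceil_div k 2 * 2.
    apply: sub; first by apply: subseq_trans (rem_subseq _ _) (rem_subseq _ _).
      by move: ez ez1; clear; lia.
    by move: e e1 se; rewrite xE; clear; lia.
  by move: e e1 ss ls; rewrite xE; clear; lia.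
have x2 : all (leq 2) (rem x s).
  by apply: has_ge2 => //; apply/allP => z /mem_rem; apply: (allP s_gt0).
have r2 : all (leq 2) r by apply/allP => z /mem_rem; apply: (allP x2).
have y2 := allP x2 y yr; have r_ge := sumn_ge2 r2.
have r_size : 0 < @size nat r by move: ez ez' ls c1; clear; lia.
have /hasP[z zr _] : has predT r by rewrite has_predT.
have zs : z \in s by apply: mem_subseq zr.
have z2 := allP r2 z zr; have er := sumn_rem zr; have ezr := size_rem_lt zr.
have q2 : all (leq 2) (rem z r) by apply/allP => w /mem_rem; apply: (allP r2).
have q_ge := sumn_ge2 q2; have es := sumn_rem zs; have ezs := size_rem_lt zs.
have [zo|ze] := boolP (odd z).
  by move: e e' se xo yo zo z2 er ezr q_ge r_lt ez ez' ls; clear; lia.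
have : sumn (rem z s) < ceil_div k 2 * 2.
  apply: (sub _ (rem_subseq _ _)); first by rewrite ezs.
  by move: es se ze; clear; lia.
by move: es er ezr q_ge ez ez' e e' ls x0 y2 yo ; clear; lia.
Qed.

Lemma sP_succ l : 0 < l -> hP l -> sP (l + 1).
Proof.
move=> l0 hl s sr sM ls; have s_gt0 := in_range_gt0 sr.
have hrem x : x \in s -> interval_sums (rem x s).
  move=> xs; apply: hl; last by have := size_rem_lt xs; lia.
    by apply/allP => y /mem_rem; apply: (allP sr).
  exact: min_idem_rem sM.
have s_1 : 1 \in s.
  have [x xs] : exists x, x \in s by case: (s) ls => [|a r _] /=; [lia|exists a; rewrite mem_head].
  by have [/mem_rem] := hrem x xs.
have [_ H] := hrem 1 s_1; split=> // m /andP[m0]; rewrite (sumn_rem s_1) => ms.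
rewrite (nsums_perm (perm_to_rem s_1)) /= mem_cat inE.
have [le|lt] := leqP m (sumn (rem 1 s)); first by rewrite H // m0.
have [->|m1] := eqVneq m 1; first by rewrite ?eqxx ?orbT.
rewrite (_ : m = 1 + (m - 1)) ?map_f ?orbT //; last by lia.
by apply: H; lia.
Qed.

Lemma in_range_nseq2 l : in_range k n (nseq l 2).
Proof. by rewrite /in_range all_nseq; apply/orP; right; lia. Qed.

Lemma all2_nseq l : all (pred1 2) (nseq l 2).
Proof. by rewrite all_nseq orbT. Qed.

Lemma sumn_nseq2 l : sumn (nseq l 2) = 2 * l.
Proof. by rewrite sumn_nseq. Qed.

Lemma nseq2_not_interval l : ~ interval_sums (nseq l 2).
Proof. by apply: not_interval_sums; rewrite mem_nseq andbF. Qed.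

Lemma hP_gt_even m : 1 < n -> ~~ odd (c * n) -> hP m -> (c * n)./2 < m.
Proof.
move=> n1 cne hm; have [kc ck c1] := ceil_div_bounds.
rewrite ltnNge; apply/negP => mc.
pose s := 3 :: nseq ((c * n)./2 - 1) 2.
have : interval_sums s.
  apply: hm; last by rewrite /= size_nseq; lia.
    by rewrite /in_range /= -/(in_range k n _) in_range_nseq2 andbT; lia.
  have q2 := all2_nseq ((c * n)./2 - 1).
  apply/idem_freeE => x /nsums_cons2[/(nsums_all2 q2)|->|[y /(nsums_all2 q2)]].
  - by rewrite size_nseq; lia.
  - have : 2 * n <= c * n by rewrite leq_mul2r c1 orbT.
    lia.
  rewrite size_nseq => -[yo ys] -> /dvdnP[q qE]; rewrite ltnNge; apply/negP => ge.
  have : c < q -> c.+1 * n <= q * n by move=> cq; rewrite leq_mul2r cq orbT.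
  have : q < c -> q.+1 * n <= c * n by move=> cq; rewrite leq_mul2r cq orbT.
  by rewrite !mulSn; case: (ltngtP q c) => [| |qc]; [lia|lia|rewrite qc in qE; lia].
by apply: not_interval_sums; rewrite inE mem_nseq andbF.
Qed.

Lemma sP_gt_even m : ~~ odd (c * n) -> sP m -> (c * n)./2 < m.
Proof.
move=> cne sm; have [kc ck c1] := ceil_div_bounds.
rewrite ltnNge; apply/negP => mc.
apply: (@nseq2_not_interval (c * n)./2); apply: sm.
- exact: in_range_nseq2.
- have e : 2 * (c * n)./2 = c * n by lia.
  split; rewrite ?sumn_nseq2 ?e ?dvdn_mull //.
    by apply: size_neq_nil; rewrite size_nseq; lia.
  move=> U Us; rewrite size_nseq => sU; apply/idem_freeE => x.
  have U2 : all (pred1 2) U by apply/allP => y /(mem_subseq Us); apply: (allP (all2_nseq _)).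
  by case/(nsums_all2 U2) => _ xs _; move: xs sU e; clear; lia.
by rewrite size_nseq.
Qed.

Lemma even_multiple x : odd (c * n) -> ~~ odd x -> n %| x -> x < (c + 1) * n -> x < c * n.
Proof.
move=> cno xe /dvdnP[q xE]; rewrite xE !ltn_mul2r n0 /= addn1 ltnS.
by rewrite leq_eqVlt => /orP[/eqP qc|//]; move: xe; rewrite xE qc cno.
Qed.

Lemma hP_gt_odd m : odd (c * n) -> hP m -> ((c + 1) * n)./2 <= m.
Proof.
move=> cno hm; have [kc ck c1] := ceil_div_bounds.
have e : ~~ odd ((c + 1) * n) by move: cno; rewrite !oddM oddD; case: (odd c); case: (odd n).
rewrite leqNgt; apply/negP => mc.
apply: (@nseq2_not_interval (((c + 1) * n)./2 - 1)); apply: hm.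
- exact: in_range_nseq2.
- apply/idem_freeE => x /(nsums_all2 (all2_nseq _)); rewrite size_nseq => -[xe xs] nx.
  by apply: even_multiple => //; lia.
by rewrite size_nseq; lia.
Qed.

Lemma sP_gt_odd m : odd (c * n) -> sP m -> ((c + 1) * n)./2 < m.
Proof.
move=> cno sm; have [kc ck c1] := ceil_div_bounds.
have cn : (c + 1) * n = c * n + n by rewrite mulnDl mul1n.
have e : 2 * ((c + 1) * n)./2 = (c + 1) * n.
  by move: cno; rewrite oddM => /andP[co no]; have : ~~ odd ((c + 1) * n); [rewrite oddM oddD co|lia].
rewrite ltnNge; apply/negP => mc.
apply: (@nseq2_not_interval ((c + 1) * n)./2); apply: sm.
- exact: in_range_nseq2.
- split; rewrite ?sumn_nseq2 ?e ?dvdn_mull //; try by lia.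
    by apply: size_neq_nil; rewrite size_nseq; lia.
  move=> U Us; rewrite size_nseq => sU; apply/idem_freeE => x.
  have U2 : all (pred1 2) U by apply/allP => y /(mem_subseq Us); apply: (allP (all2_nseq _)).
  by move=> /(nsums_all2 U2)[xe xs] nx; apply: even_multiple => //; lia.
by rewrite size_nseq; lia.
Qed.

Lemma hP_gt_1 m : n = 1 -> hP m -> (k.-1)./2 < m.
Proof.
move=> n1 hm; rewrite ltnNge; apply/negP => mc.
apply: (@nseq2_not_interval k.-1./2); apply: hm; rewrite ?size_nseq //.
  exact: in_range_nseq2.
by move=> x /(nsums_all2 (all2_nseq _)); rewrite size_nseq; lia.
Qed.

Lemma index_gt_period : let even_case := (3 <= n) && ~~ odd (c * n) in
  Smo k n <= hSmo k n + 1 /\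
  ((even_case -> (c * n)./2 + 1 <= hSmo k n <= uphalf ((c + 1) * n) - 1) /\
   (~~ even_case -> hSmo k n = ((c + 1) * n)./2)) /\
  ((even_case -> (c * n)./2 + 1 <= Smo k n <= uphalf ((c + 1) * n)) /\
   (n = 2 -> Smo k n = ((c + 1) * n)./2) /\
   (~~ even_case -> n <> 2 -> Smo k n = ((c + 1) * n)./2 + 1)).
Proof.
move=> even_case; have [kc ck c1] := ceil_div_bounds; have k0 : 0 < k by lia.
have hE := hSmo_ltE k0 n0 nk; have sE := Smo_ltE k0 n0 nk.
rewrite -/hP in hE; rewrite -/sP in sE.
have cn : (c + 1) * n = c * n + n by rewrite mulnDl mul1n.
have n1c : n = 1 -> c * n = k by move=> n1; rewrite n1 in kc ck *; lia.
pose u := if even_case then uphalf ((c + 1) * n) - 1 else ((c + 1) * n)./2.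
have u0 : 0 < u by rewrite /u /even_case; case: ifP; lia.
have hu : hP u.
  have [n2|n2] := leqP 3 n.
    by apply: hP_ge3; rewrite // /u /even_case n2; case: ifP => /=; lia.
  have [n1|n1] := eqVneq n 1.
    by apply: hP_1; rewrite // /u /even_case n1 /=; rewrite n1 in cn n1c; lia.
  have n2' : n = 2 by lia.
  have -> : u = c + 1 by rewrite /u /even_case n2' /=; lia.
  exact: hP_2.
have [/andP[h0 hle] hh hmin] := least_posP u0 hu; rewrite -hE in h0 hle hh hmin.
have su := sP_succ h0 hh.
have [|/andP[s0 sle] ss smin] := @least_posP sP (hSmo k n + 1) _ su; first by lia.
rewrite -sE in s0 sle ss smin.
have hge : ~~ even_case -> ((c + 1) * n)./2 <= hSmo k n.
  move=> ne; have [cno|cne] := boolP (odd (c * n)); first exact: hP_gt_odd.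
  have [n1|n1] := eqVneq n 1; first by have := hP_gt_1 n1 hh; have := n1c n1; lia.
  have := hP_gt_even _ cne hh; move: ne; rewrite /even_case cne; lia.
have hv : ~~ even_case -> hSmo k n = ((c + 1) * n)./2.
  by move=> ne; move: hle (hge ne); rewrite /u (negPf ne); lia.
split=> //; split; split=> //.
- move=> ec; move: (ec) => /andP[n3 cne]; have := hP_gt_even _ cne hh.
  by move: hle; rewrite /u ec; lia.
- move=> ec; move: (ec) => /andP[n3 cne]; have := sP_gt_even cne ss.
  by move: hle; rewrite /u ec; lia.
split=> [n2|ne n2].
  have sc : sP (c + 1) by apply: sP_2.
  have cne : ~~ odd (c * n) by rewrite n2; lia.
  by have := sP_gt_even cne ss; have := smin (c + 1) _ sc; rewrite n2 in cn *; lia.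
apply/eqP; rewrite eqn_leq -{1}hv // sle /= addn1.
have [cno|cne] := boolP (odd (c * n)); first exact: sP_gt_odd.
have n1 : n = 1 by move: ne; rewrite /even_case cne; lia.
by have := sP_gt_even cne ss; move: cn cne n1; clear; lia.
Qed.

End IndexGtPeriod.

(** * Zero-sum free sequences modulo n *)

Lemma sumn_ge b s : all (leq b) s -> b * size s <= sumn s.
Proof. by elim: s => [|a s IHs] /=; [lia | move=> /andP[ba /IHs]; lia]. Qed.

Definition zero_sum_free n s := all (fun x => ~~ (n %| x)) (nsums s).

Lemma idem_free_leE k n s : k <= n -> all (leq 1) s ->
  idem_free k n s <-> zero_sum_free n s.
Proof.
move=> kn s_gt0; split=> [sF|/allP sF x xs _]; last exact: sF.
apply/allP => x xs; apply/negP => nx.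
have /(leq_trans kn) kx : n <= x by rewrite dvdn_leq // (nsums_gt0 s_gt0).
by have := sF x xs kx; rewrite nx.
Qed.

Lemma zero_sum_free_subseq n s U : subseq U s -> zero_sum_free n s -> zero_sum_free n U.
Proof. by move=> Us /allP sF; apply/allP => x /(nsums_subseq Us); apply: sF. Qed.

Lemma zero_sum_free_mod n s : zero_sum_free n s -> zero_sum_free n [seq x %% n | x <- s].
Proof.
move=> /allP sF; apply/allP => y.
suff H : y \in nsums [seq x %% n | x <- s] -> exists2 x, x \in nsums s & y = x %[mod n].
  by case/H => x /sF nx; rewrite /dvdn => ->.
elim: s y {sF} => // a s IHs y /nsums_cons2[/IHs[x xs yx]|->|[z /IHs[x xs zx] ->]].
- by exists x => //; apply: nsums_subseq (subseq_cons _ _) xs.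
- by exists a; rewrite ?modn_mod //= mem_cat mem_head orbT.
exists (a + x); first by rewrite /= mem_cat inE map_f ?orbT.
by rewrite modnDml -modnDmr zx modnDmr.
Qed.

Lemma subseq_compl s U : subseq U s -> exists V : seq nat,
  [/\ subseq V s, sumn s = sumn U + sumn V & size s = size U + size V].
Proof.
elim: s U => [|a s IHs] [|b U] //=; first by exists [::].
  by exists (a :: s); rewrite eqxx.
case: eqVneq => [->|_] /IHs[V [Vs sV zV]].
  exists V; split; [exact: subseq_trans Vs (subseq_cons _ _) | lia | lia].
by exists (a :: V); rewrite eqxx Vs /= in sV zV *; split=> //; lia.
Qed.

Lemma min_zero_sum_cons k n w s : 0 < n -> k <= n -> 0 < w ->
  zero_sum_free n s -> n %| w + sumn s -> min_idem k n (w :: s).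
Proof.
move=> n0 kn w0 sF nws; split=> //.
  by apply: (leq_trans kn); apply: dvdn_leq => //=; lia.
move=> U Us sU x /nsumsP[V [VU V0 <-]] _; apply/negP => nV.
have Vws := subseq_trans VU Us.
have VsF : ~~ subseq V s.
  apply/negP => Vs; have /allP/(_ (sumn V)) := zero_sum_free_subseq Vs sF.
  by rewrite nV => /(_ (nsums_sumn V0)).
case: V => // b V in VU V0 nV Vws VsF *.
move: Vws; rewrite /=; case: eqP => [bw|_] Vs; last by rewrite Vs in VsF.
have [Z [Zs sZ zZ]] := subseq_compl Vs.
have Z0 : Z != [::].
  apply: size_neq_nil; have := size_subseq VU.
  by move: sU zZ; rewrite /=; clear; lia.
have /allP/(_ (sumn Z) (nsums_sumn Z0))/negP := zero_sum_free_subseq Zs sF; apply.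
by move: nws; rewrite sZ addnA /= in nV *; rewrite -bw dvdn_addr.
Qed.

Section SmoothModN.
Variables (n : nat) (n_gt1 : 1 < n).
Local Open Scope ring_scope.

Definition lifts_to s (g : 'Z_n) (r : seq nat) := [seq x%:R | x <- s] = [seq g *+ x | x <- r].

Definition smooth_lift s := exists (g : 'Z_n) (r : seq nat),
  [/\ has_order g n, lifts_to s g r, all (leq 1) r, (sumn r < n)%N & interval_sums r].

Lemma lifts_to_size s g r : lifts_to s g r -> size r = size s.
Proof. by move/(congr1 size); rewrite !size_map. Qed.

Lemma savchev_chen_seq s : zero_sum_free n s -> (n < 2 * size s)%N -> smooth_lift s.
Proof.
move=> /allP sF ns.
have [||g [x [og xE xS]]] :=
  @savchev_chen_Zn n n_gt1 _ (fun i : 'I_(size s) => nth 0%N s i) setT.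
- move=> J _ nJ; apply/eqP; apply: contraT => J0.
  have Js : (\sum_(i in J) nth 0 s i)%N \in nsums s by apply/nsums_index; exists J.
  by have := sF _ Js; rewrite nJ.
- by rewrite cardsT card_ord.
pose r := [seq x i | i <- enum 'I_(size s)].
have sr : size r = size s by rewrite size_map size_enum_ord.
have rn : (sumn r < n)%N.
  rewrite sumnE big_map big_enum; apply: leq_ltn_trans xS.
  by rewrite [X in (_ <= X)%N](eq_bigl predT) // => i; rewrite inE.
have r_gt0 : all (leq 1) r by apply/allP => _ /mapP[i _ ->]; have [] := xE i (in_setT i).
have r2 : (sumn r < 2 * size r)%N by rewrite sr; lia.
exists g, r; split=> //.
  rewrite /lifts_to -{1}(mkseq_nth 0%N s) /mkseq -val_enum_ord -!map_comp.
  by apply: eq_map => i /=; have [] := xE i (in_setT i).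
split; first by apply: mem1_sumn => //; lia.
by move=> m mr; apply: nsums_interval.
Qed.

Lemma smooth_lift_smooth s : smooth_lift s ->
  exists2 g : 'Z_n, has_order g n & smooth g [seq x%:R | x <- s].
Proof.
case=> g [r [og sr r0 rn ri]]; exists g => //; exists (sumn r).
  by rewrite sr; apply: smooth_shapeI.
by move=> j /andP[j0 jr]; apply: has_order_neq0 => //; lia.
Qed.

Lemma sum_lift s g r : lifts_to s g r -> (sumn s)%:R = g *+ sumn r.
Proof.
by move=> sr; rewrite -(sum_mulrn g r) -sr big_map sumnE natr_sum.
Qed.

Lemma smooth_lift_zero_sum w s : smooth_lift s -> (n %| w + sumn s)%N ->
  (n <= 2 * size s + 1)%N ->
  exists2 g : 'Z_n, has_order g n & zero_sum_smooth g [seq x%:R | x <- w :: s].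
Proof.
case=> g [r [og sr r0 rn [r1 ri]]] nw ns; exists g => //; exists n => //.
set v := (n - sumn r)%N.
have vr : (sumn (v :: r) = n)%N by rewrite /= /v; lia.
have -> : [seq x%:R | x <- w :: s] = [seq g *+ x | x <- v :: r].
  rewrite /= sr; congr (_ :: _); apply: (@addIr _ (sumn s)%:R).
  rewrite -natrD (sum_lift sr) -mulrnDr subnK ?mulrn_Zn //; last by lia.
  by apply/eqP; rewrite natr_Zn_eq0.
have szr := lifts_to_size sr; have szr' := size_leq_sumn r0.
suff : smooth_shape g [seq g *+ x | x <- v :: r] (sumn (v :: r)) by rewrite vr.
apply: smooth_shapeI; first by rewrite /= r0 andbT /v; lia.
split; first by rewrite inE r1 orbT.
move=> m; rewrite vr => /andP[m0 mn].
rewrite /= mem_cat inE; have [mr|mr] := leqP m (sumn r).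
  by rewrite ri // m0.
have [->|mv] := eqVneq m v; first by rewrite ?eqxx ?orbT.
rewrite (_ : m = (v + (m - v))%N) ?map_f ?orbT //; last by rewrite /v; lia.
by apply: ri; move: mv; rewrite /v; lia.
Qed.

Lemma smooth_shape_Zn s (g : 'Z_n) N : smooth_shape g [seq x%:R | x <- s] N ->
  exists r : seq nat, [/\ lifts_to s g r, 1%N \in r, all (leq 1) r, sumn r = N &
    forall m, (0 < m <= N)%N -> exists2 v, v \in nsums s & g *+ m = v%:R].
Proof.
case/smooth_shapeE => r [sr r1 r0 rN rS]; exists r; split=> // m /rS.
by case/(@SigmaE _ 1) => v vs ->; exists v.
Qed.

Lemma zero_sum_smooth_lift s (g : 'Z_n) : has_order g n ->
  zero_sum_smooth g [seq x%:R | x <- s] ->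
  exists r : seq nat, [/\ lifts_to s g r, 1%N \in r, all (leq 1) r, sumn r = n &
    forall m, (0 < m <= n)%N -> exists2 v, v \in nsums s & g *+ m = v%:R].
Proof.
move=> og [N /smooth_shape_Zn[r [sr r1 r0 rN rS]] [N0 gN gN']].
suff nN : N = n by rewrite nN in rN rS; exists r.
case: og => n0 gn gn'; apply/eqP; rewrite eqn_leq.
apply/andP; split; rewrite leqNgt; apply/negP => lt.
  by have := gN' n; rewrite gn eqxx n0 lt => /(_ isT).
by have := gn' N; rewrite gN eqxx N0 lt => /(_ isT).
Qed.

Lemma zero_sum_smooth_onto s (g : 'Z_n) x : has_order g n ->
  zero_sum_smooth g [seq x%:R | x <- s] -> exists2 v, v \in nsums s & (x = v %[mod n])%N.
Proof.
move=> og /(zero_sum_smooth_lift og)[r [_ _ _ _ rS]].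
have [j jn jx] := has_order_gen n_gt1 x%:R og.
have [v vs e] : exists2 v, v \in nsums s & x%:R = v%:R :> 'Z_n.
  have [j0|j0] := posnP j; last first.
    by rewrite jx; apply: rS; rewrite j0 ltnW.
  rewrite jx j0 mulr0n -(mulrn_Zn n_gt1 g); apply: rS; rewrite leqnn andbT; lia.
by exists v => //; apply/eqP; rewrite -natr_Zn_eq // e.
Qed.

End SmoothModN.

(** * Short moduli and extremal examples *)

Fixpoint words (A : seq nat) m : seq (seq nat) :=
  if m is m'.+1 then [seq a :: w | a <- A, w <- words A m'] else [:: [::]].

Lemma mem_words A s : all (mem A) s -> s \in words A (size s).
Proof.
elim: s => //= a s IHs /andP[aA /IHs sA].
by apply/allpairsP; exists (a, s).
Qed.

Definition smooth_lift_test n g s :=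
  let r := [seq index x [seq (g * j) %% n | j <- iota 0 n] | x <- s] in
  [&& coprime g n, [seq (g * x) %% n | x <- r] == s, all (leq 1) r, sumn r < n,
      1 \in r & all [in nsums r] (iota 1 (sumn r))].

Definition smooth_lift_all n l :=
  all (fun s => zero_sum_free n s ==> has (fun g => smooth_lift_test n g s) (iota 1 n))
      (words (iota 0 n) l).

Lemma smooth_lift_testP n g s : 1 < n ->
  smooth_lift_test n g [seq x %% n | x <- s] -> smooth_lift n s.
Proof.
move=> n_gt1; rewrite /smooth_lift_test; set r := [seq index _ _ | x <- _].
case/and5P => cop /eqP gr r0 rn /andP[r1 /allP ri].
have natr_modE x : (x %% n)%:R%R = x%:R%R :> 'Z_n by rewrite Zp_nat_mod.
exists g%:R%R, r; split=> //.
- split; [lia | exact: mulrn_Zn|] => j /andP[j0 jn].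
  rewrite -mulrnA natr_Zn_eq0 // Gauss_dvdr 1?coprime_sym //.
  by apply/negP => /dvdn_leq; lia.
- rewrite /lifts_to.
  have -> : [seq x%:R%R : 'Z_n | x <- s] = [seq x%:R%R | x <- [seq x %% n | x <- s]].
    by rewrite -map_comp; apply: eq_map => x /=; rewrite natr_modE.
  rewrite -gr -map_comp; apply: eq_map => x /=.
  by rewrite natr_modE -mulrnA.
by split=> // m mr; apply: ri; rewrite mem_iota; lia.
Qed.

Lemma smooth_lift_small n s : 1 < n -> smooth_lift_all n (size s) ->
  zero_sum_free n s -> smooth_lift n s.
Proof.
move=> n_gt1 /allP test sF.
have := test [seq x %% n | x <- s]; rewrite (zero_sum_free_mod sF).
have -> : [seq x %% n | x <- s] \in words (iota 0 n) (size s).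
  rewrite -(size_map (modn^~ n) s); apply: mem_words; apply/allP => _ /mapP[x _ ->].
  by rewrite inE mem_iota ltn_mod; lia.
by move=> /(_ isT)/hasP[g _]; apply: smooth_lift_testP.
Qed.

Definition hsmo_value n :=
  if n == 5 then 1 else if (n <= 4) || (n == 7) then n./2 else n./2 + 1.

Lemma zero_sum_free_smooth_lift n s : 1 < n -> zero_sum_free n s ->
  hsmo_value n <= size s -> smooth_lift n s.
Proof.
move=> n_gt1 sF ls; have [big|small] := ltnP n (2 * size s).
  exact: savchev_chen_seq.
apply: smooth_lift_small => //; move: small ls; rewrite /hsmo_value.
have [->|n5] := eqVneq n 5.
  by move=> small ls; have [->|->] : size s = 1 \/ size s = 2 by [lia|vm_compute|vm_compute].
case: ifP => [n47|]; last by lia.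
have [->|n7] := eqVneq n 7.
  by move=> small ls; have -> : size s = 3 by [lia|vm_compute].
have : n = 2 \/ n = 3 \/ n = 4 by lia.
case=> [->|[->|->]] small ls.
- by have -> : size s = 1 by [lia|vm_compute].
- by have -> : size s = 1 by [lia|vm_compute].
by have -> : size s = 2 by [lia|vm_compute].
Qed.

Definition example n :=
  if odd n then [:: 3, 3 & nseq (n - 5)./2 2] else 3 :: nseq (n./2 - 1) 2.

Lemma dvdn_lt2 n x : n %| x -> 0 < x -> x < 2 * n -> x = n.
Proof.
case/dvdnP => [[|[|q]]] ->; rewrite ?mulSn; try by lia.
Qed.

Section Example.
Variable n : nat.
Hypothesis hn : n = 6 \/ 8 <= n.

Lemma size_example : size (example n) = n./2.
Proof. by rewrite /example; case: ifP => /=; rewrite size_nseq; lia. Qed.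

Lemma sumn_example : sumn (example n) = n + 1.
Proof. by rewrite /example; case: ifP => /=; rewrite sumn_nseq2; lia. Qed.

Lemma example_in k : all (fun x => 0 < x < k + n) (example n).
Proof. by rewrite /example; case: ifP => /=; rewrite all_nseq; lia. Qed.

Lemma nsums_nseq2 l x : x \in nsums (nseq l 2) -> [/\ ~~ odd x, 0 < x & x <= 2 * l].
Proof.
move=> xl; have [xo xle] := nsums_all2 (all2_nseq l) xl; rewrite size_nseq in xle.
by split=> //; apply: nsums_gt0 xl; rewrite all_nseq orbT.
Qed.

Lemma example_free : zero_sum_free n (example n).
Proof.
apply/allP => x; rewrite /example; case: ifP => no xs; apply/negP => nx.
  have [x0 xn xo] : [/\ 0 < x, x < 2 * n & odd x -> x < n].
    case/nsums_cons2: xs => [/nsums_cons2[/nsums_nseq2[? ? ?]|->|[y /nsums_nseq2[? ? ?] ->]]|->|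
      [z /nsums_cons2[/nsums_nseq2[? ? ?]|->|[y /nsums_nseq2[? ? ?] ->]] ->]]; clear nx; split; lia.
  by have := dvdn_lt2 nx x0 xn; lia.
have [x0 xn xo] : [/\ 0 < x, x < 2 * n & x != n].
  case/nsums_cons2: xs => [/nsums_nseq2[? ? ?]|->|[y /nsums_nseq2[? ? ?] ->]]; clear nx; split; lia.
by have := dvdn_lt2 nx x0 xn; lia.
Qed.

(* Eliminating [g] from [2 = m g] and [3 = m3 g]. *)
Lemma lift_cross (g : 'Z_n) m m3 : (3%:R = g *+ m3)%R -> (2%:R = g *+ m)%R ->
  (2 * m3 = 3 * m %[mod n]).
Proof.
move=> g3 g2; apply/eqP; rewrite -natr_Zn_eq; last by lia.
by rewrite mulrnA g2 (mulrnA _ 3) g3 -!mulrnA mulnC.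
Qed.

Lemma eqmod_cases x y : x = y %[mod n] -> x = y \/ x + n <= y \/ y + n <= x.
Proof.
move/eqP; wlog le_yx : x y / y <= x.
  by move=> H; have [/H|/ltnW/H] := leqP y x; [|rewrite eq_sym]; move=> h /h; lia.
rewrite eqn_mod_dvd // => /dvdn_leq; have [->|/eqP xy] := eqVneq x y; first by left.
by move=> h; right; right; have := h; lia.
Qed.

Lemma example_sum (g : 'Z_n) r : lifts_to (example n) g r -> all (leq 1) r ->
  n <= sumn r.
Proof.
have two_lifts l (q : seq nat) : lifts_to (nseq l 2) g q ->
    size q = l /\ forall m, m \in q -> (2%:R = g *+ m)%R.
  move=> qE; split; first by rewrite (lifts_to_size qE) size_nseq.
  move=> m /(map_f (fun x => g *+ x)%R); rewrite -qE => /mapP[x].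
  by rewrite mem_nseq => /andP[_ /eqP->] <-.
rewrite /example; case: ifP => no.
  case: r => [|m3 [|m3' r]] //= [g3 g3' /two_lifts[sr r2]] /and3P[m3_gt0 m3'_gt0 r0].
  have r_mod m : m \in r -> 2 * m3 = 3 * m %[mod n] /\ 2 * m3' = 3 * m %[mod n].
    by move=> /r2 gm; split; apply: lift_cross gm.
  have sum_r b : all (leq b) r -> b * (n - 5)./2 <= sumn r by rewrite -sr; apply: sumn_ge.
  have [r_1|r_1] := boolP (1 \in r).
    have [e e'] := r_mod _ r_1; have := sum_r 1 r0.
    by have := eqmod_cases e; have := eqmod_cases e'; clear -no hn; lia.
  have r_2 := has_ge2 r0 r_1; have sum2 := sum_r 2 r_2.
  have [r_2'|r_2'] := boolP (2 \in r).
    have [e e'] := r_mod _ r_2'.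
    by have := eqmod_cases e; have := eqmod_cases e'; clear -no hn m3_gt0 m3'_gt0 sum2; lia.
  have r_3 : all (leq 3) r.
    apply/allP => x xr; have := allP r_2 x xr; rewrite leq_eqVlt => /orP[/eqP x2|//].
    by rewrite x2 xr in r_2'.
  have sum3 := sum_r 3 r_3.
  have [/andP[m3_2 m3'_2]|/nandP m3_1] := boolP ((1 < m3) && (1 < m3')).
    by clear -no hn m3_2 m3'_2 sum3; lia.
  suff : 4 * (n - 5)./2 <= sumn r by clear -no hn m3_gt0 m3'_gt0; lia.
  apply: sum_r; apply/allP => x xr; have := allP r_3 x xr.
  rewrite leq_eqVlt => /orP[/eqP x3|//]; rewrite -x3 in xr; have [e e'] := r_mod _ xr.
  by have := eqmod_cases e; have := eqmod_cases e'; clear -no hn m3_1 m3_gt0 m3'_gt0; lia.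
case: r => [|m3 r] //= [g3 /two_lifts[sr r2]] /andP[m3_gt0 r0].
have r_mod m : m \in r -> 2 * m3 = 3 * m %[mod n].
  by move=> /r2 gm; apply: lift_cross gm.
have sum_r b : all (leq b) r -> b * (n./2 - 1) <= sumn r by rewrite -sr; apply: sumn_ge.
have [r_1|r_1] := boolP (1 \in r).
  have /eqP := congr1 (fun x => x %% 2) (r_mod _ r_1).
  by rewrite !modn_dvdm ?dvdn2 ?no // modnMr.
have r_2 := has_ge2 r0 r_1; have sum2 := sum_r 2 r_2.
have [m3_2|m3_1] := ltnP 1 m3; first by clear -no hn m3_2 sum2; lia.
suff : 3 * (n./2 - 1) <= sumn r by clear -no hn m3_gt0; lia.
apply: sum_r; apply/allP => x xr; have := allP r_2 x xr.
rewrite leq_eqVlt => /orP[/eqP x2|//]; rewrite -x2 in xr; have e := r_mod _ xr.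
by have := eqmod_cases e; clear -no hn m3_1 m3_gt0; lia.
Qed.

End Example.

(** * Index at most the period *)

Definition smooth_Zn n s :=
  exists2 g : 'Z_n, has_order g n & smooth g [seq x%:R%R | x <- s].
Definition zero_sum_smooth_Zn n s :=
  exists2 g : 'Z_n, has_order g n & zero_sum_smooth g [seq x%:R%R | x <- s].

Lemma not_zero_sum_smooth_Zn n s x : 1 < n ->
  all (fun v => v %% n != x %% n) (nsums s) -> ~ zero_sum_smooth_Zn n s.
Proof.
move=> n1 /allP miss [g og] /(zero_sum_smooth_onto n1 x og)[v vs e].
by have := miss v vs; rewrite e eqxx.
Qed.

Lemma not_smooth_2_mod4 : ~ smooth_Zn 4 [:: 2].
Proof.
case=> g og [N /smooth_shape_Zn[r [sr r1 _ _ _]] _].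
case: r => [|p [|q r]] // in sr r1.
case: sr; move: r1; rewrite inE => /eqP <- g2.
by have := has_order_neq0 (j := 2) og isT; rewrite -(mulr1n g) -g2.
Qed.

Lemma not_smooth_13_mod7 : ~ smooth_Zn 7 [:: 1; 3].
Proof.
case=> g og [N /smooth_shape_Zn[r [sr r1 r0 rN rS]] _].
case: r => [|p [|q [|? ?]]] // in sr r1 r0 rN.
have [v v134 gv] : exists2 v, v \in nsums [:: 1; 3] & (g *+ 2 = v%:R)%R.
  by apply: rS; rewrite -rN /=; move: r0 => /= /and3P[]; lia.
case: sr => gp gq.
move: r1 gv; rewrite !inE => /orP[]/eqP p1.
  have -> : g = 1%:R%R by rewrite gp -p1.
  move=> /eqP.
  by move: v134; rewrite !inE => /or3P[]/eqP->.
have -> : g = 3%:R%R by rewrite gq -p1.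
move=> /eqP.
by move: v134; rewrite !inE => /or3P[]/eqP->.
Qed.

Section PeriodGeIndex.
Variables (k n : nat).
Hypotheses (k0 : 0 < k) (n1 : 1 < n) (kn : k <= n).

Let n0 : 0 < n. Proof. exact: ltnW. Qed.

Definition hQ l := forall s, in_range k n s -> idem_free k n s -> l <= size s ->
  smooth_Zn n s.
Definition sQ l := forall s, in_range k n s -> min_idem k n s -> l <= size s ->
  zero_sum_smooth_Zn n s.

Definition smo_value := if n == 5 then 3 else hsmo_value n + 1.

Lemma hQ_value : hQ (hsmo_value n).
Proof.
move=> s /in_range_gt0 s_gt0 /(idem_free_leE kn s_gt0) sF ls.
exact/smooth_lift_smooth/zero_sum_free_smooth_lift.
Qed.

Lemma sQ_value : sQ smo_value.
Proof.
case=> [_ [] //|w s] /= /andP[_ /in_range_gt0 s_gt0] [_ _ nws sub] ls.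
have sF : zero_sum_free n s.
  by apply/(idem_free_leE kn s_gt0)/sub; rewrite ?subseq_cons.
have hs : hsmo_value n <= size s /\ n <= 2 * size s + 1.
  move: ls; rewrite /smo_value /hsmo_value; have [->|n5] := eqVneq n 5; first by lia.
  by case: ifP; lia.
by apply: smooth_lift_zero_sum => //; [apply: zero_sum_free_smooth_lift|]; case: hs.
Qed.

Lemma hQ_gt s m : in_range k n s -> zero_sum_free n s -> ~ smooth_Zn n s ->
  hQ m -> size s < m.
Proof.
move=> sr sF sN hm; rewrite ltnNge; apply/negP => ms; apply/sN/hm => //.
exact/(idem_free_leE kn (in_range_gt0 sr)).
Qed.

Lemma sQ_gt w s m : in_range k n (w :: s) -> zero_sum_free n s -> n %| w + sumn s ->
  ~ zero_sum_smooth_Zn n (w :: s) -> sQ m -> (size s).+1 < m.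
Proof.
move=> sr sF nws sN hm; rewrite ltnNge; apply/negP => ms; apply/sN/hm => //.
by apply: min_zero_sum_cons => //; case/andP: sr => /andP[].
Qed.

Lemma not_smooth_example : n = 6 \/ 8 <= n -> ~ smooth_Zn n (example n).
Proof.
move=> hn [g og [N /smooth_shape_Zn[r [sr _ r0 <- _]] rn]].
have := example_sum hn sr r0 => nr; case: og => _ gn _.
by have := rn n; rewrite gn eqxx n0 nr => /(_ isT).
Qed.

Lemma not_zero_sum_smooth_example w : n = 6 \/ 8 <= n ->
  ~ zero_sum_smooth_Zn n (w :: example n).
Proof.
move=> hn [g og /(zero_sum_smooth_lift og)[[|q r] [//= sr _ /andP[q0 r0] rn _]]].
case: sr => _ /(example_sum hn)/(_ r0); lia.
Qed.

Lemma hQ_lower m : 0 < m -> hQ m -> hsmo_value n <= m.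
Proof.
move=> m0 hm; rewrite /hsmo_value; case: eqP => // n5; case: ifP => n47; last first.
  have hn : n = 6 \/ 8 <= n by lia.
  rewrite addn1 -(size_example hn); apply: hQ_gt hm; last exact: not_smooth_example.
    exact: example_in.
  exact: example_free.
have [n4|n4] := eqVneq n 4.
  suff : 1 < m by rewrite n4; lia.
  apply: (hQ_gt (s := [:: 2])) hm; first by rewrite /in_range /=; lia.
    by rewrite n4.
  by rewrite n4; apply: not_smooth_2_mod4.
have [n7|n7] := eqVneq n 7; last by lia.
suff : 2 < m by rewrite n7; lia.
apply: (hQ_gt (s := [:: 1; 3])) hm; first by rewrite /in_range /=; lia.
  by rewrite n7.
by rewrite n7; apply: not_smooth_13_mod7.
Qed.

Lemma sQ_lower m : sQ m -> smo_value <= m.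
Proof.
move=> hm; rewrite /smo_value /hsmo_value; have [n5|n5] := eqVneq n 5.
  apply: (sQ_gt (w := 1) (s := [:: 4])) hm; first by rewrite /in_range /=; lia.
  - by rewrite n5.
  - by rewrite n5.
  by apply: (@not_zero_sum_smooth_Zn _ _ 2) => //; rewrite n5.
case: ifP => n47; last first.
  have hn : n = 6 \/ 8 <= n by lia.
  rewrite !addn1 -(size_example hn).
  apply: (sQ_gt (w := n - 1)) hm; last exact: not_zero_sum_smooth_example.
  - by rewrite /in_range /= example_in // andbT; lia.
  - exact: example_free.
  by rewrite (sumn_example hn) (_ : _ + _ = 2 * n) ?dvdn_mull //; lia.
have [n4|n4] := eqVneq n 4.
  suff : 2 < m by rewrite n4; lia.
  apply: (sQ_gt (w := 2) (s := [:: 2])) hm; first by rewrite /in_range /=; lia.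
  - by rewrite n4.
  - by rewrite n4.
  by apply: (@not_zero_sum_smooth_Zn _ _ 1) => //; rewrite n4.
have [n7|n7] := eqVneq n 7.
  suff : 3 < m by rewrite n7; lia.
  apply: (sQ_gt (w := 1) (s := [:: 1; 5])) hm; first by rewrite /in_range /=; lia.
  - by rewrite n7.
  - by rewrite n7.
  by apply: (@not_zero_sum_smooth_Zn _ _ 3) => //; rewrite n7.
suff : 1 < m by lia.
apply: (sQ_gt (w := n) (s := [::])) hm => //.
- by rewrite /in_range /=; lia.
- by rewrite addn0.
by apply: (@not_zero_sum_smooth_Zn _ _ 1) => //=; rewrite modnn modn_small.
Qed.

Lemma hSmo_value : hSmo k n = hsmo_value n.
Proof.
rewrite (hSmo_leE k0 n0 kn n1); apply: least_pos_eq; last exact: hQ_lower.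
  by rewrite /hsmo_value; do 2 case: ifP => //; lia.
exact: hQ_value.
Qed.

Lemma Smo_value : Smo k n = smo_value.
Proof.
rewrite (Smo_leE k0 n0 kn n1); apply: least_pos_eq; last by move=> m _; apply: sQ_lower.
  by rewrite /smo_value; case: ifP => //; lia.
exact: sQ_value.
Qed.

End PeriodGeIndex.

(* x./2 and uphalf x are the floor and the ceiling of x / 2. *)
Theorem theorem4p4 (k n : nat) (hk : 0 < k) (hn : 0 < n) :
  (k <= n ->
     (n = 5 -> Smo k n = 3 /\ hSmo k n = 1) /\
     (n <> 5 ->
        Smo k n = hSmo k n + 1 /\
        (n <= 4 \/ n = 7 -> hSmo k n = n./2) /\
        (n = 6 \/ 8 <= n -> hSmo k n = n./2 + 1))) /\
  (n < k ->
     let c := ceil_div k n in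
     let even_case := (3 <= n) && ~~ odd (c * n) in
     Smo k n <= hSmo k n + 1 /\
     ((even_case ->
         (c * n)./2 + 1 <= hSmo k n <= uphalf ((c + 1) * n) - 1) /\
      (~~ even_case -> hSmo k n = ((c + 1) * n)./2)) /\
     ((even_case ->
         (c * n)./2 + 1 <= Smo k n <= uphalf ((c + 1) * n)) /\
      (n = 2 -> Smo k n = ((c + 1) * n)./2) /\
      (~~ even_case -> n <> 2 -> Smo k n = ((c + 1) * n)./2 + 1))).
Proof.
split=> [kn|nk]; last exact: index_gt_period.
have [n1|n1] := ltnP 1 n.
  rewrite (hSmo_value hk n1 kn) (Smo_value hk n1 kn) /smo_value /hsmo_value.
  split=> [->//|/eqP/negPf n5]; rewrite n5; split=> //; split.
    by move=> h; rewrite ifT //; lia.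
  by move=> h; rewrite ifF //; lia.
have [-> ->] : k = 1 /\ n = 1 by lia.
by rewrite /Smo /hSmo /=; split=> // _; split=> //; split=> //; lia.
Qed.
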